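(* Let $g\in\Bbbk[c]$ with $\deg g\geq1$, let $f=cg$ and let $P=P(f,g)$ with $u=d-a$. Let $\sigma(x)=g^{-1}xg$ and $\delta(x)=\theta x-\sigma(x)\theta$ with $\theta=g^{-1}\left(a^2+(u-g)a\right)$; these restrict to an automorphism and a $\sigma$-derivation of $P$ given, with $h=cg'$ and $\gamma=h+u+2a$, by $\sigma(c)=c$, $\sigma(u)=u$, $\sigma(a)=a+h$, $\delta(c)=c\gamma$, $\delta(u)=u\gamma$, $\delta(a)=(h-u)a$. Then the ring $\mathcal{G}_f:=G\left(f,g,g^{-1}(a^2+(u-g)a)\right)=P[b;\sigma,\delta]$ is a Generalized Jordanian Matrix Algebra (GJMA). Moreover, $\mathcal{G}_{c^2}=M_J(2)$ (with $d=a+u$).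
   Context: $\Bbbk$ is an algebraically closed field of characteristic zero; $g'$ is the usual derivative of $g$ with respect to $c$. A skew polynomial ring $R[x;\sigma,\delta]$ (with $\sigma$ an automorphism of $R$ and $\delta$ a $\Bbbk$-linear $\sigma$-derivation, $\delta(rs)=\sigma(r)\delta(s)+\delta(r)s$) has commutation rule $xr=\sigma(r)x+\delta(r)$. For $f,g\in\Bbbk[c]$, $P(f,g)$ is the $\Bbbk$-algebra on generators $a,c,d$ with relations $ac=ca+f$, $dc=cd+f$, $da=(a-g)d+ga$. Equivalently, with $u=d-a$, it is generated by $a,c,u$ with relations $ac=ca+f$, $uc=cu$, $au=ua+gu$. It has an involution (automorphism of order two) $\tau$ with $\tau(a)=d$, $\tau(d)=a$, $\tau(c)=c$ (so $\tau(u)=-u$). The element $g^{-1}$ lives in the localization of $P$ at the powers of the irreducible factors of $f$. $M_J(2)$ is the $\Bbbk$-algebra on generators $a,b,c,d$ with relations $ac=ca+c^2$, $bc=cb+ca+cd+c^2$, $dc=cd+c^2$, $bd=db+cb+cd-ad+d^2$, $da=ad-cd+ca$, $ba=ab+cb+cd-ad+a^2$. Two rings are birationally equivalent if their classical quotient rings are isomorphic (as $\Bbbk$-algebras). A skew polynomial ring $M=P(f,g)[b;\sigma,\delta]$ is a Generalized Jordanian Matrix Algebra (GJMA) if it is birationally equivalent to $M_J(2)$ and the involution $\tau$ of $P(f,g)$ extends to an automorphism of $M$ with $\tau(b)=b$. (It is known that $M_J(2)$ is birationally equivalent to $A_1(\Bbbk[s,t])$, the first Weyl algebra over $\Bbbk[s,t]$.)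 *)

(* Defs.v *)
From HB Require Import structures.
From mathcomp Require Import all_boot all_order all_algebra.
From mathcomp Require Import boolp.
From mathcomp Require Import monalg.

Set Implicit Arguments.
Unset Strict Implicit.
Unset Printing Implicit Defensive.

Import GRing.Theory.
Local Open Scope ring_scope.

Section SkewData.
Variables (k : fieldType) (A : algType k).

Record skew_data := SkewData {
  skew_aut : {lrmorphism A -> A};
  skew_der : {linear A -> A};
  skew_aut_bij : bijective skew_aut;
  skew_derM : forall r s : A,
    skew_der (r * s) = skew_aut r * skew_der s + skew_der r * s
}.

End SkewData.

(* A[x; sigma, delta], with coefficients on the left of the powers of x: the  *)
(* additive group of {poly A} with the multiplication given by the rule       *)
(* x r = sigma(r) x + delta(r).                                               *)
Definition skew_poly (k : fieldType) (A : algType k) (D : skew_data A) : Type :=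
  {poly A}.

Section SkewPoly.
Variables (k : fieldType) (A : algType k) (D : skew_data A).
Local Notation sigma := (skew_aut D).
Local Notation delta := (skew_der D).
Local Notation M := (skew_poly D).
Implicit Types (p q r : {poly A}) (c : A) (a : k).

(* Left multiplication by x. *)
Definition skew_shift q : {poly A} := map_poly sigma q * 'X + map_poly delta q.

Definition skew_mul p q : {poly A} :=
  \sum_(i < size p) p`_i *: iter i skew_shift q.

Local Notation X_ := skew_shift.
Local Notation "p ** q" := (skew_mul p q) (at level 40, left associativity).

Lemma skew_shiftD p q : X_ (p + q) = X_ p + X_ q.
Proof. by rewrite /skew_shift !raddfD /= mulrDl addrACA. Qed.

Lemma skew_shift0 : X_ 0 = 0.
Proof. by rewrite /skew_shift !raddf0 mul0r addr0. Qed.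

Lemma skew_shift_sum n (F : 'I_n -> {poly A}) :
  X_ (\sum_i F i) = \sum_i X_ (F i).
Proof. exact: (big_morph _ skew_shiftD skew_shift0). Qed.

Lemma skew_shiftZ c q : X_ (c *: q) = sigma c *: X_ q + delta c *: q.
Proof.
have h1 : map_poly sigma (c *: q) = sigma c *: map_poly sigma q.
  by apply/polyP=> i; rewrite !(coef_map, coefZ) /= rmorphM.
have h2 : map_poly delta (c *: q)
        = sigma c *: map_poly delta q + delta c *: q.
  by apply/polyP=> i; rewrite coefD !(coef_map, coefZ) /= skew_derM.
by rewrite /skew_shift h1 h2 scalerDr scalerAl addrA.
Qed.

Lemma skew_mulw n p q : (size p <= n)%N ->
  p ** q = \sum_(i < n) p`_i *: iter i X_ q.
Proof.
move=> le_pn; rewrite /skew_mul -!(big_mkord xpredT (fun i => p`_i *: iter i X_ q)).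
rewrite [RHS](big_cat_nat (n := size p)) //=.
rewrite [X in _ = _ + X]big_nat_cond [X in _ = _ + X]big1 ?addr0 //.
by move=> i /andP[/andP[le_pi _] _]; rewrite nth_default // scale0r.
Qed.

Lemma skew_mulDl p q r : (p + q) ** r = p ** r + q ** r.
Proof.
pose n := maxn (size p) (size q).
rewrite (@skew_mulw n (p + q)) ?size_polyD // (@skew_mulw n p) ?leq_maxl //.
rewrite (@skew_mulw n q) ?leq_maxr // -big_split /=.
by apply: eq_bigr => i _; rewrite coefD scalerDl.
Qed.

Lemma skew_mulDr p q r : p ** (q + r) = p ** q + p ** r.
Proof.
rewrite /skew_mul -big_split /=; apply: eq_bigr => i _.
rewrite -scalerDr; congr (_ *: _).
by elim: (i : nat) => //= j ->; rewrite skew_shiftD.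
Qed.

Lemma skew_mulZl c p q : (c *: p) ** q = c *: (p ** q).
Proof.
rewrite (@skew_mulw (size p)) ?size_scale_leq // scaler_sumr.
by apply: eq_bigr => i _; rewrite coefZ scalerA.
Qed.

Lemma skew_mul0l q : 0 ** q = 0.
Proof. by rewrite /skew_mul size_poly0 big_ord0. Qed.

Lemma skew_mul_suml n (F : 'I_n -> {poly A}) q :
  (\sum_i F i) ** q = \sum_i F i ** q.
Proof.
exact: (big_morph (skew_mul^~ q) (fun p r => skew_mulDl p r q) (skew_mul0l q)).
Qed.

Lemma skew_mul_shift p q : X_ p ** q = X_ (p ** q).
Proof.
have le1 : (size (map_poly sigma p * 'X)%R <= (size p).+1)%N.
  rewrite (leq_trans (size_polyMleq _ _)) // size_polyX addn2 /= ltnS.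
  exact: size_poly.
have le2 : (size (map_poly delta p) <= size p)%N by exact: size_poly.
rewrite /skew_shift skew_mulDl (skew_mulw _ le1) (skew_mulw _ le2).
rewrite -/(X_ _) [in RHS]/skew_mul skew_shift_sum.
rewrite big_ord_recl coefMX /= scale0r add0r -big_split /=.
by apply: eq_bigr => i _; rewrite skew_shiftZ coefMX /= !coef_map.
Qed.

Lemma skew_mulA : associative skew_mul.
Proof.
move=> p q r; rewrite [p ** q]/skew_mul skew_mul_suml.
apply: eq_bigr => i _; rewrite skew_mulZl; congr (_ *: _).
by elim: (i : nat) => //= j ->; rewrite skew_mul_shift.
Qed.

Lemma skew_der1 : delta 1 = 0.
Proof.
have := skew_derM D 1 1; rewrite mulr1 rmorph1 mul1r mulr1 => /eqP.
by rewrite -subr_eq subrr eq_sym => /eqP.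
Qed.

Lemma skew_iter1 i : iter i X_ 1 = 'X^i.
Proof.
elim: i => [|i IHi]; rewrite ?expr0 //= IHi /skew_shift map_polyXn exprSr.
rewrite [X in _ + X](_ : _ = 0) ?addr0 //.
apply/polyP=> j; rewrite coef_map coefXn coef0 /=.
by case: eqP => _; rewrite ?skew_der1 ?raddf0.
Qed.

Lemma skew_mul1l : left_id 1 skew_mul.
Proof. by move=> q; rewrite /skew_mul size_poly1 big_ord1 coef1 scale1r. Qed.

Lemma skew_mul1r : right_id 1 skew_mul.
Proof.
move=> p; rewrite /skew_mul -[RHS]coefK poly_def.
by apply: eq_bigr => i _; rewrite skew_iter1.
Qed.

Lemma skew_oner_neq0 : (1 : {poly A}) != 0. Proof. exact: oner_neq0. Qed.

HB.instance Definition _ := GRing.Zmodule.copy M {poly A}.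
HB.instance Definition _ := GRing.Zmodule_isNzRing.Build M
  skew_mulA skew_mul1l skew_mul1r skew_mulDl skew_mulDr skew_oner_neq0.

Definition skew_scale a p : {poly A} := a%:A *: p.

Lemma skew_scaleA a b p : skew_scale a (skew_scale b p) = skew_scale (a * b) p.
Proof. by rewrite /skew_scale scalerA -scalerAl mul1r scalerA. Qed.

Lemma skew_scale1 : left_id 1 skew_scale.
Proof. by move=> p; rewrite /skew_scale !scale1r. Qed.

Lemma skew_scaleDr : right_distributive skew_scale +%R.
Proof. by move=> a p q; rewrite /skew_scale scalerDr. Qed.

Lemma skew_scaleDl p : {morph skew_scale^~ p : a b / a + b}.
Proof. by move=> a b; rewrite /skew_scale !scalerDl. Qed.

HB.instance Definition _ := GRing.Zmodule_isLmodule.Build k M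
  skew_scaleA skew_scale1 skew_scaleDr skew_scaleDl.

Lemma skew_scaleAl a (p q : M) : a *: (p * q) = (a *: p) * q.
Proof. exact/esym/skew_mulZl. Qed.

HB.instance Definition _ := GRing.Lmodule_isLalgebra.Build k M skew_scaleAl.

Lemma skew_scaleAr a (p q : M) : a *: (p * q) = p * (a *: q).
Proof.
rewrite [LHS]scaler_sumr; apply: eq_bigr => i _ /=.
have shiftZ r : X_ (a%:A *: r) = a%:A *: X_ r.
  by rewrite skew_shiftZ !linearZ /= rmorph1 skew_der1 scaler0 scale0r addr0.
have ->: iter i X_ (a%:A *: (q : {poly A})) = a%:A *: iter i X_ q.
  by elim: (i : nat) => //= j ->.
rewrite -[LHS]/(a%:A *: (p`_i *: iter i X_ q)).
by rewrite !scalerA mulr_algl mulr_algr.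
Qed.

HB.instance Definition _ := GRing.Lalgebra_isAlgebra.Build k M skew_scaleAr.

Definition skewX : M := ('X : {poly A}).
Definition skewC (c : A) : M := (c%:P : {poly A}).

Lemma skewC_is_zmod_morphism : zmod_morphism skewC.
Proof. exact: polyCB. Qed.

Lemma skewC_is_monoid_morphism : monoid_morphism skewC.
Proof.
split=> // c d; rewrite /skewC [RHS]/GRing.mul /= (@skew_mulw 1) ?size_polyC_leq1 //.
by rewrite big_ord1 coefC /= polyCM mul_polyC.
Qed.

Lemma skewC_is_scalable : scalable skewC.
Proof.
move=> a c; rewrite /skewC [RHS]/(_ *: _) /= /skew_scale.
by rewrite -mul_polyC -polyCM mulr_algl.
Qed.

HB.instance Definition _ :=
  GRing.isZmodMorphism.Build A M skewC skewC_is_zmod_morphism.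
HB.instance Definition _ :=
  GRing.isMonoidMorphism.Build A M skewC skewC_is_monoid_morphism.
HB.instance Definition _ :=
  GRing.isScalable.Build k A M *:%R skewC skewC_is_scalable.

Lemma skewX_mulC (r : A) :
  skewX * skewC r = skewC (sigma r) * skewX + skewC (delta r).
Proof.
have mulC1 (c : A) (q : M) : skewC c * q = (c *: (q : {poly A}) : {poly A}).
  rewrite /skewC [LHS]/GRing.mul /= (@skew_mulw 1) ?size_polyC_leq1 //.
  by rewrite big_ord1 coefC.
rewrite mulC1 /skewX [LHS]/GRing.mul /= /skew_mul size_polyX.
rewrite big_ord_recl big_ord1 !coefX /= scale0r add0r scale1r.
by rewrite /skew_shift !map_polyC /= mul_polyC.
Qed.

End SkewPoly.

Record gen_alg (k : fieldType) (n : nat) := GenAlg {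
  gen_alg_alg :> algType k;
  gen : 'I_n -> gen_alg_alg
}.
Arguments gen {k n} g i.

Definition free_malg (k : fieldType) (n : nat) : Type :=
  {malg k[{fmonom 'I_n}]}.

Section FreeAlgebra.
Variables (k : fieldType) (n : nat).
Local Notation F := (free_malg k n).

HB.instance Definition _ := GRing.Lalgebra.copy F {malg k[{fmonom 'I_n}]}.

Lemma free_scaleAr (a : k) (p q : F) : a *: (p * q) = p * (a *: q).
Proof.
have central (r : {malg k[{fmonom 'I_n}]}) : a%:MP * r = r * a%:MP.
  rewrite !malgM_def fgmulUg fgmulgU.
  by apply: eq_bigr => m _; rewrite mulrC mul1m mulm1.
have scaleE (r : F) : a *: r = a%:MP * r by rewrite mul_malgC.
by rewrite !scaleE mulrA central mulrA.
Qed.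

HB.instance Definition _ := GRing.Lalgebra_isAlgebra.Build k F free_scaleAr.

(* Locked: unification diverges when it unfolds the operations of {malg _}.   *)
Fact free_alg_key : unit. Proof. by []. Qed.
Definition free_alg : gen_alg k n :=
  locked_with free_alg_key (@GenAlg k n F (fun i => << fmu i >>)).

Section Eval.
Variables (B : algType k) (x : 'I_n -> B).

Definition free_word (w : {fmonom 'I_n}) : B := \prod_(i <- w) x i.

Lemma free_word_is_mmorphism : mmorphism free_word.
Proof.
by split=> [w1 w2|]; rewrite /free_word ?fmM ?big_cat // fm1 big_nil.
Qed.

HB.instance Definition _ :=
  isMultiplicative.Build {fmonom 'I_n} B free_word free_word_is_mmorphism.

Definition free_eval : F -> B := mmap (in_alg B) free_word.

Lemma free_eval_is_zmod_morphism : zmod_morphism free_eval.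
Proof. exact: mmap_is_additive. Qed.

Lemma free_eval_is_monoid_morphism : monoid_morphism free_eval.
Proof.
have comm_f (g : {malg k[{fmonom 'I_n}]}) m m' :
    GRing.comm (in_alg B g@_m) (free_word m').
  by rewrite /GRing.comm /= mulr_algl mulr_algr.
by have [h1 h2] := commr_mmap_is_multiplicative comm_f.
Qed.

Lemma free_eval_is_scalable : scalable free_eval.
Proof. by move=> a p; rewrite /free_eval mmapZ mulr_algl. Qed.

HB.instance Definition _ :=
  GRing.isZmodMorphism.Build F B free_eval free_eval_is_zmod_morphism.
HB.instance Definition _ :=
  GRing.isMonoidMorphism.Build F B free_eval free_eval_is_monoid_morphism.
HB.instance Definition _ :=
  GRing.isScalable.Build k F B *:%R free_eval free_eval_is_scalable.

Lemma free_alg_ex :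
  exists phi : {lrmorphism free_alg -> B}, forall i, phi (gen free_alg i) = x i.
Proof.
rewrite /free_alg unlock; exists free_eval => i /=.
by rewrite /free_eval mmapU /= scale1r mul1r /free_word fmU big_seq1.
Qed.

End Eval.

End FreeAlgebra.

(* The two-sided ideal generated by S. *)
Inductive gen_ideal (R : nzRingType) (S : R -> Prop) : R -> Prop :=
| gen_ideal_in x : S x -> gen_ideal S x
| gen_ideal_0 : gen_ideal S 0
| gen_ideal_D x y : gen_ideal S x -> gen_ideal S y -> gen_ideal S (x + y)
| gen_ideal_M r s x : gen_ideal S x -> gen_ideal S (r * x * s).

Section GenIdeal.
Variables (R : nzRingType) (S : R -> Prop).

Definition gen_ideal_pred : {pred R} := fun x => `[< gen_ideal S x >].

Lemma gen_ideal_zmod_closed : zmod_closed gen_ideal_pred.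
Proof.
split=> [|x y]; first exact/asboolP/gen_ideal_0.
move=> /asboolP Sx /asboolP Sy; apply/asboolP; apply: gen_ideal_D => //.
by rewrite -mulN1r -[_ * _]mulr1; apply: gen_ideal_M.
Qed.

HB.instance Definition _ :=
  GRing.isZmodClosed.Build R gen_ideal_pred gen_ideal_zmod_closed.

Lemma gen_idealMl r x : x \in gen_ideal_pred -> r * x \in gen_ideal_pred.
Proof.
by move=> /asboolP Sx; apply/asboolP; rewrite -[_ * _]mulr1; apply: gen_ideal_M.
Qed.

Lemma gen_idealMr r x : x \in gen_ideal_pred -> x * r \in gen_ideal_pred.
Proof.
move=> /asboolP Sx; apply/asboolP; rewrite -[x * r]mul1r mulrA.
exact: gen_ideal_M.
Qed.

Lemma gen_ideal_kernel (B : nzRingType) (phi : {rmorphism R -> B}) x :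
  (forall y, S y -> phi y = 0) -> gen_ideal S x -> phi x = 0.
Proof.
move=> phiS; elim=> {x} [x /phiS||x y _ IHx _ IHy|r s x _ IHx] //.
- exact: rmorph0.
- by rewrite rmorphD IHx IHy addr0.
- by rewrite !rmorphM IHx mulr0 mul0r.
Qed.

End GenIdeal.

(* The quotient of F by the two-sided ideal generated by S. An algType being  *)
(* a nonzero ring, S comes with a proof that this ideal is proper.            *)
Definition quot_alg (k : fieldType) (F : algType k) (S : F -> Prop)
  (properS : ~ gen_ideal S 1) : Type := Quotient.quot (gen_ideal_pred S).

Section QuotAlg.
Variables (k : fieldType) (F : algType k) (S : F -> Prop).
Variable properS : ~ gen_ideal S 1.
Local Notation I := (gen_ideal_pred S).
Local Notation Q := (quot_alg properS).
Local Open Scope quotient_scope.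

HB.instance Definition _ := GRing.Zmodule.copy Q (Quotient.quot I).
HB.instance Definition _ := EqQuotient.copy Q (Quotient.quot I).

Definition quot_pi (p : F) : Q := \pi_(Quotient.quot I) p.
Definition quot_repr (q : Q) : F := repr (q : Quotient.quot I).

Lemma quot_reprK q : quot_pi (quot_repr q) = q. Proof. exact: reprK. Qed.

Lemma quot_piE p q : (quot_pi p = quot_pi q) <-> gen_ideal S (p - q).
Proof.
split=> [/eqP|h]; first by rewrite -Quotient.idealrBE => /asboolP.
by apply/eqP; rewrite -Quotient.idealrBE; apply/asboolP.
Qed.

Lemma quot_pi_is_zmod_morphism : zmod_morphism quot_pi.
Proof. by move=> p q; rewrite /quot_pi raddfB. Qed.

HB.instance Definition _ :=
  GRing.isZmodMorphism.Build F Q quot_pi quot_pi_is_zmod_morphism.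

Definition quot_one : Q := quot_pi 1.
Definition quot_mul (x y : Q) : Q := quot_pi (quot_repr x * quot_repr y).
Definition quot_scale (a : k) (x : Q) : Q := quot_pi (a *: quot_repr x).

Lemma quot_repr_pi p : quot_repr (quot_pi p) - p \in I.
Proof. by apply/asboolP/quot_piE; rewrite quot_reprK. Qed.

Lemma quot_piM p q : quot_pi (p * q) = quot_mul (quot_pi p) (quot_pi q).
Proof.
apply/esym/quot_piE/asboolP; set p' := quot_repr _; set q' := quot_repr _.
have ->: p' * q' - p * q = (p' - p) * q' + p * (q' - q).
  by rewrite mulrBl mulrBr addrA subrK.
rewrite -[is_true _]/(is_true (_ \in I)).
by apply: rpredD; [apply: gen_idealMr|apply: gen_idealMl]; exact: quot_repr_pi.
Qed.

Lemma quot_piZ a p : quot_pi (a *: p) = quot_scale a (quot_pi p).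
Proof.
apply/esym/quot_piE/asboolP; rewrite -scalerBr -mulr_algl.
exact/gen_idealMl/quot_repr_pi.
Qed.

Lemma quot_mulA : associative quot_mul.
Proof.
move=> x y z; rewrite -[x]quot_reprK -[y]quot_reprK -[z]quot_reprK.
by rewrite -!quot_piM mulrA.
Qed.

Lemma quot_mul1l : left_id quot_one quot_mul.
Proof. by move=> x; rewrite -[x]quot_reprK -quot_piM mul1r. Qed.

Lemma quot_mul1r : right_id quot_one quot_mul.
Proof. by move=> x; rewrite -[x]quot_reprK -quot_piM mulr1. Qed.

Lemma quot_mulDl : left_distributive quot_mul +%R.
Proof.
move=> x y z; rewrite -[x]quot_reprK -[y]quot_reprK -[z]quot_reprK.
by rewrite -raddfD -!quot_piM mulrDl raddfD.
Qed.

Lemma quot_mulDr : right_distributive quot_mul +%R.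
Proof.
move=> x y z; rewrite -[x]quot_reprK -[y]quot_reprK -[z]quot_reprK.
by rewrite -raddfD -!quot_piM mulrDr raddfD.
Qed.

Lemma quot_oner_neq0 : quot_one != 0.
Proof.
by apply/eqP; rewrite -(raddf0 quot_pi) => /quot_piE; rewrite subr0.
Qed.

HB.instance Definition _ := GRing.Zmodule_isNzRing.Build Q
  quot_mulA quot_mul1l quot_mul1r quot_mulDl quot_mulDr quot_oner_neq0.

Lemma quot_pi_is_monoid_morphism : monoid_morphism quot_pi.
Proof. by split; [exact: (erefl quot_one) | exact: quot_piM]. Qed.

HB.instance Definition _ :=
  GRing.isMonoidMorphism.Build F Q quot_pi quot_pi_is_monoid_morphism.

Lemma quot_scaleA a b x : quot_scale a (quot_scale b x) = quot_scale (a * b) x.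
Proof. by rewrite -[x]quot_reprK -!quot_piZ scalerA. Qed.

Lemma quot_scale1 : left_id 1 quot_scale.
Proof. by move=> x; rewrite -[x]quot_reprK -quot_piZ scale1r. Qed.

Lemma quot_scaleDr : right_distributive quot_scale +%R.
Proof.
move=> a x y; rewrite -[x]quot_reprK -[y]quot_reprK.
by rewrite -raddfD -!quot_piZ scalerDr raddfD.
Qed.

Lemma quot_scaleDl x : {morph quot_scale^~ x : a b / a + b}.
Proof.
by move=> a b; rewrite -[x]quot_reprK -!quot_piZ scalerDl raddfD.
Qed.

HB.instance Definition _ := GRing.Zmodule_isLmodule.Build k Q
  quot_scaleA quot_scale1 quot_scaleDr quot_scaleDl.

HB.instance Definition _ :=
  GRing.isScalable.Build k F Q *:%R quot_pi quot_piZ.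

Lemma quot_scaleAl a (x y : Q) : a *: (x * y) = (a *: x) * y.
Proof.
rewrite -[x]quot_reprK -[y]quot_reprK.
by rewrite -rmorphM -!linearZ -rmorphM /= scalerAl.
Qed.

HB.instance Definition _ := GRing.Lmodule_isLalgebra.Build k Q quot_scaleAl.

Lemma quot_scaleAr a (x y : Q) : a *: (x * y) = x * (a *: y).
Proof.
rewrite -[x]quot_reprK -[y]quot_reprK.
by rewrite -rmorphM -!linearZ -rmorphM /= scalerAr.
Qed.

HB.instance Definition _ := GRing.Lalgebra_isAlgebra.Build k Q quot_scaleAr.

End QuotAlg.

(* The k-algebra on n generators with relators S. *)
Section Presented.
Variables (k : fieldType) (n : nat) (S : free_alg k n -> Prop).
Variable properS : ~ gen_ideal S 1.

Fact presented_key : unit. Proof. by []. Qed.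
Definition presented : gen_alg k n :=
  locked_with presented_key
    (@GenAlg k n (quot_alg properS)
       (fun i => quot_pi properS (gen (free_alg k n) i))).

Lemma presented_pi :
  exists pi : {lrmorphism free_alg k n -> presented},
    [/\ forall i, pi (gen (free_alg k n) i) = gen presented i,
        forall x, exists p, x = pi p
      & forall p, pi p = 0 <-> gen_ideal S p].
Proof.
rewrite /presented unlock; exists (quot_pi properS); split=> //= [x|p].
  by exists (quot_repr x); rewrite quot_reprK.
by rewrite -(raddf0 (quot_pi properS)) quot_piE subr0.
Qed.

End Presented.

Section JordanianSubalgebra.
Variables (k : fieldType) (f g : {poly k}).

Local Notation a := (gen (free_alg k 3) (Ordinal (isT : 0 < 3)%N)).
Local Notation c := (gen (free_alg k 3) (Ordinal (isT : 1 < 3)%N)).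
Local Notation d := (gen (free_alg k 3) (Ordinal (isT : 2 < 3)%N)).

(* horner_alg c f is f(c). *)
Inductive P_relator : free_alg k 3 -> Prop :=
| P_relator_ac : P_relator (a * c - (c * a + horner_alg c f))
| P_relator_dc : P_relator (d * c - (c * d + horner_alg c f))
| P_relator_da : P_relator (d * a - ((a - horner_alg c g) * d + horner_alg c g * a)).

(* f d/dc on k[c]. *)
Definition P_model_der (p : {poly k}) : {poly k} := f * p^`().

Lemma P_model_der_is_zmod_morphism : zmod_morphism P_model_der.
Proof. by move=> p q; rewrite /P_model_der linearB mulrBr. Qed.

Lemma P_model_der_is_scalable : scalable P_model_der.
Proof. by move=> a p; rewrite /P_model_der linearZ scalerAr. Qed.

HB.instance Definition _ :=
  GRing.isZmodMorphism.Build {poly k} {poly k} P_model_der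
    P_model_der_is_zmod_morphism.
HB.instance Definition _ :=
  GRing.isScalable.Build k {poly k} {poly k} *:%R P_model_der
    P_model_der_is_scalable.

Lemma P_model_derM (r s : {poly k}) :
  P_model_der (r * s) = r * P_model_der s + P_model_der r * s.
Proof. by rewrite /P_model_der derivM mulrDr addrC mulrCA !mulrA. Qed.

Definition P_model_data : skew_data {poly k} :=
  @SkewData k {poly k} idfun P_model_der (Bijective (fun=> erefl) (fun=> erefl))
    P_model_derM.

Lemma lrmorph_horner_alg (A B : algType k) (phi : {lrmorphism A -> B}) x p :
  phi (horner_alg x p) = horner_alg (phi x) p.
Proof.
elim/poly_ind: p => [|p c IHp]; first by rewrite !rmorph0.
rewrite !rmorphD !rmorphM /= !horner_algX !horner_algC IHp.
by rewrite linearZ /= rmorph1.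
Qed.

Lemma horner_alg_polyX (p : {poly k}) : horner_alg 'X p = p.
Proof.
elim/poly_ind: p => [|p c IHp]; first by rewrite rmorph0.
by rewrite rmorphD rmorphM /= horner_algX horner_algC IHp alg_polyC.
Qed.

Lemma P_relator_eval (B : algType k) (phi : {lrmorphism free_alg k 3 -> B}) :
  phi a * phi c = phi c * phi a + horner_alg (phi c) f ->
  phi d * phi c = phi c * phi d + horner_alg (phi c) f ->
  phi d * phi a = (phi a - horner_alg (phi c) g) * phi d
                  + horner_alg (phi c) g * phi a ->
  forall y, P_relator y -> phi y = 0.
Proof.
move=> ac dc da y [].
- by rewrite rmorphB rmorphD !rmorphM /= lrmorph_horner_alg ac subrr.
- by rewrite rmorphB rmorphD !rmorphM /= lrmorph_horner_alg dc subrr.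
- rewrite rmorphB rmorphD !rmorphM rmorphB /= !lrmorph_horner_alg da.
  exact: subrr.
Qed.

(* a and d act as f d/dc on k[c], so P(f,g) is a nonzero ring. *)
Lemma P_relator_proper : ~ gen_ideal P_relator 1.
Proof.
pose X := skewX P_model_data.
pose c := skewC P_model_data 'X.
have comm : X * c = c * X + horner_alg c f.
  rewrite -lrmorph_horner_alg horner_alg_polyX /X /c skewX_mulC /=.
  by rewrite /P_model_der derivX mulr1.
pose x (i : 'I_3) := if val i == 1%N then c else X.
have [phi phiE] := free_alg_ex x.
have rel0 : forall y, P_relator y -> phi y = 0.
  apply: P_relator_eval; rewrite !phiE //.
  by rewrite mulrBl subrK.
by move=> /(gen_ideal_kernel rel0)/eqP; rewrite rmorph1 oner_eq0.
Qed.

Definition Palg : gen_alg k 3 := presented P_relator_proper.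
Definition P_a : Palg := gen Palg (Ordinal (isT : 0 < 3)%N).
Definition P_c : Palg := gen Palg (Ordinal (isT : 1 < 3)%N).
Definition P_d : Palg := gen Palg (Ordinal (isT : 2 < 3)%N).
Definition P_u : Palg := P_d - P_a.
Definition P_poly (p : {poly k}) : Palg := horner_alg P_c p.

Definition is_tau (tau : {lrmorphism Palg -> Palg}) : Prop :=
  [/\ involutive tau, tau P_a = P_d, tau P_d = P_a & tau P_c = P_c].

(* The multiplicative set generated by the irreducible factors of f. *)
Definition P_factors (s : Palg) : Prop :=
  exists2 ps : seq {poly k},
    (forall p, p \in ps -> irreducible_poly p /\ p %| f)
    & s = P_poly (\prod_(p <- ps) p).

End JordanianSubalgebra.

Section JordanianMatrixAlgebra.
Variable k : fieldType.

Local Notation a := (gen (free_alg k 4) (Ordinal (isT : 0 < 4)%N)).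
Local Notation b := (gen (free_alg k 4) (Ordinal (isT : 1 < 4)%N)).
Local Notation c := (gen (free_alg k 4) (Ordinal (isT : 2 < 4)%N)).
Local Notation d := (gen (free_alg k 4) (Ordinal (isT : 3 < 4)%N)).

Inductive MJ2_relator : free_alg k 4 -> Prop :=
| MJ2_relator_ac : MJ2_relator (a * c - (c * a + c ^+ 2))
| MJ2_relator_bc : MJ2_relator (b * c - (c * b + c * a + c * d + c ^+ 2))
| MJ2_relator_dc : MJ2_relator (d * c - (c * d + c ^+ 2))
| MJ2_relator_bd :
    MJ2_relator (b * d - (d * b + c * b + c * d - a * d + d ^+ 2))
| MJ2_relator_da : MJ2_relator (d * a - (a * d - c * d + c * a))
| MJ2_relator_ba :
    MJ2_relator (b * a - (a * b + c * b + c * d - a * d + a ^+ 2)).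

Lemma MJ2_relator_eval (B : algType k) (phi : {lrmorphism free_alg k 4 -> B}) :
  let a' := phi a in let b' := phi b in let c' := phi c in let d' := phi d in
  a' * c' = c' * a' + c' ^+ 2 ->
  b' * c' = c' * b' + c' * a' + c' * d' + c' ^+ 2 ->
  d' * c' = c' * d' + c' ^+ 2 ->
  b' * d' = d' * b' + c' * b' + c' * d' - a' * d' + d' ^+ 2 ->
  d' * a' = a' * d' - c' * d' + c' * a' ->
  b' * a' = a' * b' + c' * b' + c' * d' - a' * d' + a' ^+ 2 ->
  forall y, MJ2_relator y -> phi y = 0.
Proof.
move=> /= ac bc dc bd da ba y [];
  rewrite !(rmorphB, rmorphD, rmorphM, rmorphXn) /=.
- by rewrite ac subrr.
- by rewrite bc subrr.
- by rewrite dc subrr.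
- by rewrite bd subrr.
- by rewrite da subrr.
- by rewrite ba subrr.
Qed.

(* All generators can be sent to 0 in k. *)
Lemma MJ2_relator_proper : ~ gen_ideal MJ2_relator 1.
Proof.
have [phi phiE] := free_alg_ex (fun _ : 'I_4 => 0 : k^o).
have rel0 : forall y, MJ2_relator y -> phi y = 0.
  by apply: MJ2_relator_eval; rewrite /= !phiE ?expr0n !mul0r ?(addr0, subr0).
by move=> /(gen_ideal_kernel rel0)/eqP; rewrite rmorph1 oner_eq0.
Qed.

Definition MJ2 : gen_alg k 4 := presented MJ2_relator_proper.
Definition MJ2_a : MJ2 := gen MJ2 (Ordinal (isT : 0 < 4)%N).
Definition MJ2_b : MJ2 := gen MJ2 (Ordinal (isT : 1 < 4)%N).
Definition MJ2_c : MJ2 := gen MJ2 (Ordinal (isT : 2 < 4)%N).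
Definition MJ2_d : MJ2 := gen MJ2 (Ordinal (isT : 3 < 4)%N).

End JordanianMatrixAlgebra.

Section Fractions.
Variable k : fieldType.

(* Q is the two-sided ring of fractions of R with respect to S, via iota. *)
Definition is_fraction_ring (R : algType k) (S : R -> Prop)
    (Q : unitAlgType k) (iota : {lrmorphism R -> Q}) : Prop :=
  [/\ forall s, S s -> iota s \is a GRing.unit,
      forall q, exists s r, S s /\ q = (iota s)^-1 * iota r,
      forall q, exists s r, S s /\ q = iota r / iota s
    & forall r, [/\ iota r = 0 <-> (exists2 s, S s & s * r = 0)
                  & iota r = 0 <-> (exists2 s, S s & r * s = 0)]].

Definition regular (R : nzRingType) (s : R) : Prop := GRing.lreg s /\ GRing.rreg s.

Definition is_classical_quotient (R : algType k) (Q : unitAlgType k)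
    (iota : {lrmorphism R -> Q}) : Prop :=
  is_fraction_ring (@regular R) iota.

Definition birational (R1 R2 : algType k) : Prop :=
  exists (Q1 : unitAlgType k) (iota1 : {lrmorphism R1 -> Q1})
         (Q2 : unitAlgType k) (iota2 : {lrmorphism R2 -> Q2}),
    [/\ is_classical_quotient iota1, is_classical_quotient iota2
      & exists phi : {lrmorphism Q1 -> Q2}, bijective phi].

End Fractions.

Section GJMA.
Variables (k : fieldType) (f g : {poly k}) (D : skew_data (Palg f g)).

Definition is_GJMA : Prop :=
  birational (skew_poly D) (MJ2 k) /\
  exists2 tau : {lrmorphism Palg f g -> Palg f g}, is_tau tau &
    exists T : {lrmorphism skew_poly D -> skew_poly D},
      [/\ bijective T, forall r, T (skewC D r) = skewC D (tau r)
        & T (skewX D) = skewX D].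

(* sigma(x) = g^-1 x g and delta(x) = theta x - sigma(x) theta, where g and   *)
(* theta live in the overring L of P(f,g).                                    *)
Definition is_G_data (L : unitAlgType k) (iota : {lrmorphism Palg f g -> L})
    (theta : L) : Prop :=
  let gL := iota (P_poly f g g) in
  (forall x, iota (skew_aut D x) = gL^-1 * iota x * gL) /\
  (forall x, iota (skew_der D x) = theta * iota x - iota (skew_aut D x) * theta).

End GJMA.

(* Main.v *)
Require Import Defs.
From HB Require Import structures.
From mathcomp Require Import all_boot all_order all_algebra.
From mathcomp Require Import finmap boolp monalg.

(** Let P = P(f,g) with f = c g, w = a^2 + (u - g) a = g theta and h = c g'.

    The maps sigma and delta. The relations of P give g (a + h) = a g, while g
    commutes with c and u, so that a |-> a + h defines the automorphism sigma
    with g sigma(x) = x g. For delta one needs w x - x w to be divisible by g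
    on the left; this holds for the generators by explicit commutators, and
    then for all of P because such x form a subalgebra. As P is a domain,
    delta(x) is the unique quotient, and all formulas for sigma and delta can
    be multiplied by g and checked in P. Over the localization of P, where g is
    invertible, they become the conjugation by g and the formula with theta
    ([G_data_ex], [is_G_dataP]).

    Domains and localizations. P is k[c][a; f d/dc][u; sigma'], with sigma'
    shifting a by -g ([P_model]), and skew polynomial rings over Ore domains
    are Ore domains by Euclid's algorithm ([ore_domain_skew]); so P and M =
    P[b; sigma, delta] are Ore domains. Multiplicative sets of polynomials in c
    are Ore sets because commutators with such polynomials stay in a smaller
    ring ([left_ore_at_commutator]). Ore localizations exist in general
    ([ore_localization]).

    Birational equivalence. In M the element y = g (b - theta) = g b - w
    commutes with P. Once k[c] is inverted, a = c g D and b = g^-1 (y + w),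
    where D acts as d/dc on k[c], and D and c commute with u/c and y. Thus the
    localization is generated by c, D, u/c, y, which satisfy relations
    independent of g: for two polynomials g1, g2, the algebras become equal
    when c, u, y and a1/g1, a2/g2 are identified. So the quotient division ring
    of the algebra of g2 is also a quotient ring of the algebra of g1. The
    embedding is built from the presentation ([twisted_hom]); its injectivity
    and the fact that it reaches all fractions both follow by clearing
    denominators in k[c], simultaneously in the two quotient division rings
    ([linked_denominator], [birational_G]).

    For g = c the algebra is M_J(2), as the two presentations imply each other
    ([G_iso_MJ2]); this is the last assertion, and taking g2 = c in the
    previous paragraph gives the birational equivalence with M_J(2). Finally
    tau extends to M with b fixed because it commutes with sigma and delta
    ([tau_extends]). *)

Set Implicit Arguments.
Unset Strict Implicit.
Unset Printing Implicit Defensive.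

Import GRing.Theory.
Local Open Scope ring_scope.

(** * Identities in noncommutative rings *)

(** Reflection of ring expressions whose atoms need not commute: an expression
    is expanded into a list of integer multiples of words, two multiples of the
    same word being merged on insertion, and an identity of free rings holds as
    soon as every remaining multiple is zero. *)
Inductive nc_expr :=
  | NCvar of nat | NCone | NCzero
  | NCadd of nc_expr & nc_expr | NCopp of nc_expr | NCmul of nc_expr & nc_expr.

Section NoncommutativeRing.
Variables (R : nzRingType) (env : seq R).

Fixpoint nc_eval (e : nc_expr) : R :=
  match e with
  | NCvar i => env`_i
  | NCone => 1
  | NCzero => 0
  | NCadd e1 e2 => nc_eval e1 + nc_eval e2
  | NCopp e1 => - nc_eval e1
  | NCmul e1 e2 => nc_eval e1 * nc_eval e2
  end.

Definition nc_word (t : int * seq nat) : R := (\prod_(i <- t.2) env`_i) *~ t.1.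
Definition nc_sum (l : seq (int * seq nat)) : R := \sum_(t <- l) nc_word t.

Fixpoint nc_insert (t : int * seq nat) (l : seq (int * seq nat)) :=
  if l is t' :: l' then
    if t.2 == t'.2 then (t.1 + t'.1, t.2) :: l' else t' :: nc_insert t l'
  else [:: t].

Fixpoint nc_norm (e : nc_expr) : seq (int * seq nat) :=
  match e with
  | NCvar i => [:: (1, [:: i])]
  | NCone => [:: (1, [::])]
  | NCzero => [::]
  | NCadd e1 e2 => foldr nc_insert (nc_norm e2) (nc_norm e1)
  | NCopp e1 => [seq (- t.1, t.2) | t <- nc_norm e1]
  | NCmul e1 e2 =>
    [seq (t1.1 * t2.1, t1.2 ++ t2.2) | t1 <- nc_norm e1, t2 <- nc_norm e2]
  end.

Lemma nc_sum_insert t l : nc_sum (nc_insert t l) = nc_word t + nc_sum l.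
Proof.
elim: l => [|t' l IHl] /=; first by rewrite /nc_sum big_seq1 big_nil addr0.
case: eqP => [e|_]; rewrite /nc_sum !big_cons; last first.
  by rewrite -/(nc_sum _) IHl addrCA.
by rewrite /nc_word /= e mulrzDr addrA.
Qed.

Lemma nc_normE e : nc_sum (nc_norm e) = nc_eval e.
Proof.
rewrite /nc_sum; elim: e => [i||| e1 IH1 e2 IH2|e IHe|e1 IH1 e2 IH2] /=.
- by rewrite big_seq1 /nc_word /= big_seq1.
- by rewrite big_seq1 /nc_word /= big_nil.
- by rewrite big_nil.
- rewrite -IH1 -IH2; elim: (nc_norm e1) => [|t l IHl] /=.
    by rewrite big_nil add0r.
  by rewrite -/(nc_sum _) nc_sum_insert /nc_sum IHl big_cons addrA.
- rewrite -IHe big_map -sumrN; apply: eq_bigr => t _.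
  by rewrite /nc_word /= mulrNz.
- rewrite -IH1 -IH2 big_allpairs_dep /= big_distrl; apply: eq_bigr => t1 _.
  rewrite big_distrr; apply: eq_bigr => t2 _.
  by rewrite /nc_word /= big_cat /= mulrzAl mulrzAr -mulrzA [(t1.1 * _)%R]mulrC.
Qed.

Lemma nc_eqP e1 e2 :
  all (fun t => t.1 == 0) (nc_norm (NCadd e1 (NCopp e2))) ->
  nc_eval e1 = nc_eval e2.
Proof.
move=> h; apply/eqP; rewrite -subr_eq0; apply/eqP.
rewrite -[LHS]/(nc_eval (NCadd e1 (NCopp e2))) -nc_normE /nc_sum big_seq.
by rewrite big1 // => t /(allP h)/eqP t0; rewrite /nc_word t0.
Qed.

End NoncommutativeRing.

(* Atoms are compared up to conversion, because the same element often occurs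
   with different paths through the hierarchy of algebraic structures. *)
Ltac nc_index x l :=
  match l with
  | ?y :: _ => let _ := match goal with _ => unify x y end in constr:(0%N)
  | _ :: ?l' => let n := nc_index x l' in constr:(S n)
  end.

Ltac nc_mem x l :=
  match l with
  | nil => constr:(false)
  | ?y :: _ => let _ := match goal with _ => unify x y end in constr:(true)
  | _ :: ?l' => nc_mem x l'
  end.

Ltac nc_atoms t l :=
  match t with
  | 0 => l
  | 1 => l
  | ?x + ?y => let l' := nc_atoms x l in nc_atoms y l'
  | - ?x => nc_atoms x l
  | ?x * ?y => let l' := nc_atoms x l in nc_atoms y l'
  | _ => match nc_mem t l with true => l | false => constr:(t :: l) end
  end.

Ltac nc_reify t l :=
  match t with
  | 0 => constr:(NCzero)
  | 1 => constr:(NCone)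
  | ?x + ?y =>
    let x' := nc_reify x l in let y' := nc_reify y l in constr:(NCadd x' y')
  | - ?x => let x' := nc_reify x l in constr:(NCopp x')
  | ?x * ?y =>
    let x' := nc_reify x l in let y' := nc_reify y l in constr:(NCmul x' y')
  | _ => let i := nc_index t l in constr:(NCvar i)
  end.

(** Proves the identities that hold for arbitrary values of the atoms in an
    arbitrary ring; the relations between the atoms have to be rewritten
    beforehand. *)
Ltac noncomm :=
  rewrite ?expr2 ?mulr2n;
  lazymatch goal with
  | |- @eq ?T ?x ?y =>
    let l := nc_atoms x (@nil T) in
    let l := nc_atoms y l in
    let ex := nc_reify x l in
    let ey := nc_reify y l in
    refine (@nc_eqP _ l ex ey _); vm_compute; reflexivity
  end.

(** * Algebras given by generators and relations *)

Lemma lrmorphism_ex (k : fieldType) (A B : algType k) (f : A -> B) :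
  {morph f : x y / x + y} -> {morph f : x y / x * y} -> f 1 = 1 ->
  (forall a x, f (a *: x) = a *: f x) ->
  exists phi : {lrmorphism A -> B}, phi =1 f.
Proof.
move=> fD fM f1 fZ.
have fB : zmod_morphism f.
  by move=> x y; rewrite fD -[- y]scaleN1r fZ scaleN1r.
have fM1 : monoid_morphism f by split.
pose phi : {lrmorphism A -> B} := HB.pack f
  (GRing.isZmodMorphism.Build A B f fB)
  (GRing.isMonoidMorphism.Build A B f fM1)
  (GRing.isScalable.Build k A B *:%R f fZ).
by exists phi.
Qed.

(** Membership in a subalgebra is how a property is checked on generators only:
    the induction principles of free, presented and skew polynomial algebras
    below all take a proof of [subalgebra Pr]. *)
Record subalgebra (k : fieldType) (A : algType k) (Pr : A -> Prop) : Prop :=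
  Subalgebra {
    subalgebra1 : Pr 1;
    subalgebraD : forall x y, Pr x -> Pr y -> Pr (x + y);
    subalgebraM : forall x y, Pr x -> Pr y -> Pr (x * y);
    subalgebraZ : forall c x, Pr x -> Pr (c *: x)
  }.

Section Subalgebra.
Variables (k : fieldType) (A : algType k) (Pr : A -> Prop).
Hypothesis subPr : subalgebra Pr.

Lemma subalgebra0 : Pr 0.
Proof.
by rewrite -(scale0r (1 : A)); apply/(subalgebraZ subPr)/(subalgebra1 subPr).
Qed.

Lemma subalgebra_sum (I : Type) (r : seq I) (F : I -> A) :
  (forall i, Pr (F i)) -> Pr (\sum_(i <- r) F i).
Proof.
move=> PF; elim: r => [|i r IHr]; first by rewrite big_nil; apply: subalgebra0.
by rewrite big_cons; apply: (subalgebraD subPr).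
Qed.

End Subalgebra.

Lemma subalgebra_eq (k : fieldType) (A B : algType k)
  (phi psi : {lrmorphism A -> B}) : subalgebra (fun x => phi x = psi x).
Proof.
split=> [|x y ex ey|x y ex ey|c x ex].
- by rewrite !rmorph1.
- by rewrite !rmorphD /= ex ey.
- by rewrite !rmorphM /= ex ey.
- by rewrite !linearZ /= ex.
Qed.

Lemma subalgebra_preim (k : fieldType) (A B : algType k)
    (phi : {lrmorphism A -> B}) Pr :
  subalgebra Pr -> subalgebra (fun x => Pr (phi x)).
Proof.
case=> P1 PD PM PZ; split=> [|x y|x y|c x].
- by rewrite rmorph1.
- by rewrite rmorphD; apply: PD.
- by rewrite rmorphM; apply: PM.
- by rewrite linearZ; apply: PZ.
Qed.

Lemma free_alg_ind (k : fieldType) n (Pr : free_alg k n -> Prop) :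
  subalgebra Pr -> (forall i, Pr (gen (free_alg k n) i)) -> forall x, Pr x.
Proof.
move: Pr; rewrite /free_alg unlock /= => Pr subPr Pgen x.
have PU (m : {fmonom 'I_n}) : Pr (<< m >> : free_malg k n).
  case: m; elim=> [|i s IHs]; first by rewrite -fmoneE; case: subPr.
  have -> : (<< FMonom (i :: s) >> : free_malg k n)
            = << fmu i >> * << FMonom s >>.
    rewrite [RHS]fgmulUU mulr1; congr (<< _ >>).
    by rewrite -[RHS]/(fmmul _ _) fmmulE fmuE.
  exact: (subalgebraM subPr).
have -> : x = \sum_(m <- msupp x) x@_m *: (<< m >> : free_malg k n).
  rewrite [LHS]monalgE; apply: eq_bigr => m _.
  by rewrite -mul_malgC [RHS]fgmulUU mul1m mulr1.
by apply: (subalgebra_sum subPr) => m; apply: (subalgebraZ subPr).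
Qed.

Section PresentedTheory.
Variables (k : fieldType) (n : nat) (S : free_alg k n -> Prop).
Variable properS : ~ gen_ideal S 1.
Local Notation Q := (presented properS).

Lemma presented_ind (Pr : Q -> Prop) :
  subalgebra Pr -> (forall i, Pr (gen Q i)) -> forall x, Pr x.
Proof.
move=> subPr Pgen x; have [pi [piE pi_surj _]] := presented_pi properS.
have [p ->] := pi_surj x; move: p.
apply: (free_alg_ind (subalgebra_preim pi subPr)) => i.
by rewrite piE.
Qed.

(** The relations are tested on the images of the relators in B, as these are
    given as elements of the free algebra. *)
Lemma presented_hom (B : algType k) (x : 'I_n -> B) :
  (forall phi : {lrmorphism free_alg k n -> B},
     (forall i, phi (gen (free_alg k n) i) = x i) ->
     forall y, S y -> phi y = 0) ->
  exists psi : {lrmorphism Q -> B}, forall i, psi (gen Q i) = x i.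
Proof.
have [phi phiE] := free_alg_ex x => /(_ phi phiE) phiS.
have [pi [piE pi_surj pi_ker]] := presented_pi properS.
have phi_pi p q : pi p = pi q -> phi p = phi q.
  move=> epq; apply/eqP; rewrite -subr_eq0 -rmorphB; apply/eqP.
  by apply: (gen_ideal_kernel phiS); apply/pi_ker; rewrite rmorphB /= epq subrr.
pose lift q := projT1 (cid (pi_surj q)).
have liftK q : pi (lift q) = q by rewrite /lift; case: cid.
have [||||psi psiE] := @lrmorphism_ex k Q B (fun q => phi (lift q)).
- by move=> q r; rewrite -rmorphD; apply: phi_pi; rewrite rmorphD /= !liftK.
- by move=> q r; rewrite -rmorphM; apply: phi_pi; rewrite rmorphM /= !liftK.
- by rewrite -(rmorph1 phi); apply: phi_pi; rewrite rmorph1 liftK.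
- by move=> a q; rewrite -linearZ; apply: phi_pi; rewrite linearZ /= !liftK.
exists psi => i; rewrite psiE -phiE; apply: phi_pi.
by rewrite liftK piE.
Qed.

End PresentedTheory.

(** * Polynomials in one element, and the algebra P(f,g) *)

Lemma horner_algM (k : fieldType) (A : algType k) (x : A) (p q : {poly k}) :
  horner_alg x (p * q) = horner_alg x p * horner_alg x q.
Proof. exact: rmorphM. Qed.

Lemma horner_alg_comm (k : fieldType) (A : algType k) (x y : A) (p : {poly k}) :
  y * x = x * y -> y * horner_alg x p = horner_alg x p * y.
Proof.
move=> yx; elim/poly_ind: p => [|p c IHp].
  by rewrite rmorph0 mulr0 mul0r.
rewrite rmorphD rmorphM /= horner_algX horner_algC mulrDr mulrDl.
by rewrite mulrA IHp -!mulrA yx mulr_algl mulr_algr.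
Qed.

Lemma horner_alg_mulC (k : fieldType) (A : algType k) (x : A) (p q : {poly k}) :
  horner_alg x p * horner_alg x q = horner_alg x q * horner_alg x p.
Proof. by rewrite -!rmorphM /= mulrC. Qed.

(** Bracketing with y and applying f d/dx are both derivations of k[x]; the
    hypothesis says that they agree at x. *)
Lemma horner_alg_der (k : fieldType) (A : algType k) (x y : A) (f p : {poly k}) :
  y * x = x * y + horner_alg x f ->
  y * horner_alg x p = horner_alg x p * y + horner_alg x (f * p^`()).
Proof.
move=> yx; elim/poly_ind: p => [|p c IHp].
  by rewrite deriv0 mulr0 rmorph0 mulr0 mul0r addr0.
set F := horner_alg x f in yx *; set H := horner_alg x p in IHp *.
set G := horner_alg x (f * p^`()) in IHp *.
have -> : horner_alg x (f * (p * 'X + c%:P)^`()) = H * F + G * x.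
  rewrite derivMXaddC mulrDr mulrA rmorphD /= !horner_algM horner_algX.
  by rewrite (horner_alg_mulC x f p) /G horner_algM.
rewrite rmorphD /= horner_algM horner_algX horner_algC -/H.
set C : A := c%:A; have yC : y * C = C * y by rewrite mulr_algl mulr_algr.
by rewrite mulrDr mulrA IHp yC mulrDl -[H * y * x]mulrA yx; noncomm.
Qed.

Section P_theory.
Variables (k : fieldType) (f g : {poly k}).
Local Notation P := (Palg f g).
Local Notation a := (P_a f g).
Local Notation c := (P_c f g).
Local Notation d := (P_d f g).
Local Notation u := (P_u f g).
Local Notation poly := (P_poly f g).

Lemma P_dE : d = a + u.
Proof. by rewrite /P_u addrC subrK. Qed.

(** The generators a, c, u are more convenient than a, c, d: the relation
    between a and u has two terms only, and u commutes with c. *)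
Lemma P_ind (Pr : P -> Prop) :
  subalgebra Pr -> Pr a -> Pr c -> Pr u -> forall x, Pr x.
Proof.
move=> subPr Pa Pc Pu; apply: (presented_ind subPr) => -[[|[|[|//]]] lt_i3].
- by move: Pa; rewrite /P_a; congr (Pr (gen _ _)); apply: val_inj.
- by move: Pc; rewrite /P_c; congr (Pr (gen _ _)); apply: val_inj.
- have := subalgebraD subPr Pa Pu; rewrite -P_dE /P_d.
  by congr (Pr (gen _ _)); apply: val_inj.
Qed.

Lemma P_hom (B : algType k) (xa xc xu : B) :
  xa * xc = xc * xa + horner_alg xc f -> xu * xc = xc * xu ->
  xa * xu = xu * xa + horner_alg xc g * xu ->
  exists phi : {lrmorphism P -> B}, [/\ phi a = xa, phi c = xc & phi u = xu].
Proof.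
move=> ac uc au.
pose x (i : 'I_3) :=
  if val i is i.+1 then (if i is 0 then xc else xa + xu) else xa.
have [|phi phiE] := @presented_hom k 3 _ (@P_relator_proper k f g) B x.
  move=> phi phiE; apply: P_relator_eval; rewrite !phiE /x //=.
  - by rewrite mulrDl ac uc; noncomm.
  - by rewrite mulrDl !mulrDr !mulrBl au; noncomm.
have ea : phi a = xa := phiE _; have ed : phi d = xa + xu := phiE _.
exists phi; split; [exact: ea | exact: phiE |].
by rewrite rmorphB /= ea ed; noncomm.
Qed.

Lemma P_hom_ext (B : algType k) (phi psi : {lrmorphism P -> B}) :
  phi a = psi a -> phi c = psi c -> phi u = psi u -> phi =1 psi.
Proof. by move=> ea ec eu; apply: (P_ind (subalgebra_eq phi psi)). Qed.

Lemma P_ac : a * c = c * a + poly f.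
Proof.
have [pi [piE _ pi_ker]] := presented_pi (@P_relator_proper k f g).
have /pi_ker/eqP := gen_ideal_in (P_relator_ac f g).
by rewrite rmorphB rmorphD !rmorphM /= lrmorph_horner_alg !piE subr_eq0 => /eqP.
Qed.

Lemma P_dc : d * c = c * d + poly f.
Proof.
have [pi [piE _ pi_ker]] := presented_pi (@P_relator_proper k f g).
have /pi_ker/eqP := gen_ideal_in (P_relator_dc f g).
by rewrite rmorphB rmorphD !rmorphM /= lrmorph_horner_alg !piE subr_eq0 => /eqP.
Qed.

Lemma P_da : d * a = (a - poly g) * d + poly g * a.
Proof.
have [pi [piE _ pi_ker]] := presented_pi (@P_relator_proper k f g).
have /pi_ker/eqP := gen_ideal_in (P_relator_da f g).
rewrite rmorphB rmorphD !rmorphM rmorphB /= lrmorph_horner_alg !piE.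
by rewrite subr_eq0 => /eqP.
Qed.

Lemma P_uc : u * c = c * u.
Proof. by rewrite /P_u mulrBl mulrBr P_dc P_ac; noncomm. Qed.

Lemma P_au : a * u = u * a + poly g * u.
Proof. by rewrite /P_u mulrBl !mulrBr P_da; noncomm. Qed.

End P_theory.

(** * Homomorphisms from skew polynomial rings *)

Section SkewPolyTheory.
Variables (k : fieldType) (A : algType k) (D : skew_data A).
Local Notation sigma := (skew_aut D).
Local Notation delta := (skew_der D).
Local Notation M := (skew_poly D).
Local Notation X := (skewX D).
Local Notation C := (skewC D).

Lemma skewCM_scale r (q : M) : C r * q = (r *: (q : {poly A}) : {poly A}).
Proof.
rewrite /skewC [LHS]/GRing.mul /= (@skew_mulw _ _ _ 1) ?size_polyC_leq1 //.
by rewrite big_ord1 coefC.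
Qed.

Lemma skew_shiftE (q : M) : skew_shift D q = X * q.
Proof.
rewrite /skewX [RHS]/GRing.mul /= /skew_mul size_polyX.
by rewrite big_ord_recl big_ord1 !coefX /= scale0r add0r scale1r.
Qed.

Lemma skewXnE n : X ^+ n = ('X^n : {poly A}).
Proof.
elim: n => [|n IHn]; first by rewrite !expr0.
rewrite exprS IHn -skew_shiftE -(skew_iter1 D n).
by rewrite -[LHS](iterS n (skew_shift D)) skew_iter1.
Qed.

Lemma skewMX (q : M) : q * X = ((q : {poly A}) * 'X : {poly A}).
Proof.
rewrite [LHS]/GRing.mul /= /skew_mul -[in RHS](coefK (q : {poly A})) poly_def.
have shift1 : skew_shift D 1 = 'X by rewrite -['X]expr1 -(skew_iter1 D).
rewrite mulr_suml; apply: eq_bigr => i _.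
by rewrite -[RHS]scalerAl -exprSr -(skew_iter1 D i.+1) iterSr shift1.
Qed.

Lemma skew_ind (Pr : M -> Prop) :
  subalgebra Pr -> (forall r, Pr (C r)) -> Pr X -> forall p, Pr p.
Proof.
move=> subPr PC PX; elim/poly_ind => [|p r IHp].
  exact: (subalgebra0 subPr).
rewrite -skewMX; apply: (subalgebraD subPr (x := (p : M) * X) (y := C r)) => //.
exact: (subalgebraM subPr).
Qed.

Lemma skew_hom_ext (B : algType k) (phi psi : {lrmorphism M -> B}) :
  (forall r, phi (C r) = psi (C r)) -> phi X = psi X -> phi =1 psi.
Proof. by move=> eC eX; apply: (skew_ind (subalgebra_eq phi psi)). Qed.

(** The extension evaluates at b the polynomial whose coefficients have been
    mapped to B by phi; the commutation rule satisfied by b makes this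
    evaluation multiplicative. *)
Lemma skew_hom (B : algType k) (phi : {lrmorphism A -> B}) (b : B) :
  (forall r, b * phi r = phi (sigma r) * b + phi (delta r)) ->
  exists Phi : {lrmorphism M -> B},
    (forall r, Phi (C r) = phi r) /\ Phi X = b.
Proof.
move=> b_phi; pose F (p : M) : B := (map_poly phi (p : {poly A})).[b].
have F_C r : F (C r) = phi r by rewrite /F map_polyC hornerC.
have F_X : F X = b by rewrite /F map_polyX hornerX.
have FD : {morph F : p q / p + q}.
  by move=> p q; rewrite /F rmorphD hornerD.
have FCM r q : F (C r * q) = phi r * F q.
  rewrite skewCM_scale /F -hornerZ; congr _.[b].
  by apply/polyP=> i; rewrite !(coef_map, coefZ) /= rmorphM.
have FMX p : F (p * X) = F p * b.
  by rewrite skewMX /F rmorphM /= map_polyX hornerMX.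
have FXM q : F (X * q) = b * F q.
  elim/poly_ind: q => [|q r IHq].
    by rewrite mulr0 /F rmorph0 horner0 mulr0.
  rewrite -[(q * 'X : {poly A})]skewMX -[r%:P]/(C r) mulrDr !FD mulrA !FMX IHq.
  by rewrite mulrDr mulrA skewX_mulC FD FMX !F_C b_phi.
have FM : {morph F : p q / p * q}.
  move=> p q; elim/poly_ind: p => [|p r IHp] in q *.
    by rewrite mul0r /F rmorph0 horner0 mul0r.
  rewrite -[(p * 'X : {poly A})]skewMX -[r%:P]/(C r) mulrDl !FD FCM -mulrA IHp.
  by rewrite FXM FMX F_C mulrDl mulrA.
have F1 : F 1 = 1 := etrans (F_C 1) (rmorph1 phi).
have FZ a p : F (a *: p) = a *: F p.
  by rewrite -mulr_algl -(rmorph1 C) -linearZ FCM linearZ rmorph1 mulr_algl.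
have [Phi PhiE] := @lrmorphism_ex k M B F FD FM F1 FZ.
by exists Phi; split=> [r|]; rewrite PhiE.
Qed.

Lemma skew_size_shift_iter n i (q : {poly A}) :
  (size q <= n.+1)%N ->
  (size (iter i (skew_shift D) q) <= (n + i).+1)%N /\
  (iter i (skew_shift D) q)`_(n + i) = iter i sigma q`_n.
Proof.
move=> le_qn; elim: i => [|i [IHs IHc]] /=; first by rewrite addn0.
set p := iter _ _ _ in IHs IHc *.
have sd : (size (map_poly delta p) <= (n + i).+1)%N.
  exact: leq_trans (size_poly _ _) IHs.
have ss : (size (map_poly sigma p) <= (n + i).+1)%N.
  exact: leq_trans (size_poly _ _) IHs.
rewrite /skew_shift addnS; split.
  rewrite (leq_trans (size_polyD _ _)) // geq_max (leqW sd) andbT.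
  by rewrite (leq_trans (size_polyMleq _ _)) // size_polyX addn2.
rewrite coefD coefMX /= [X in _ + X]nth_default // addr0.
by rewrite coef_map /= IHc.
Qed.

(** The degree bounds m and n need not be attained: the coefficient of degree m
    + n is then still the product of the coefficients of degrees m and n,
    twisted by the m-th power of sigma. *)
Lemma skew_coefM m n (p q : M) :
  (size (p : {poly A}) <= m.+1)%N -> (size (q : {poly A}) <= n.+1)%N ->
  (size ((p * q)%R : {poly A}) <= (n + m).+1)%N /\
  ((p * q)%R : {poly A})`_(n + m)
  = (p : {poly A})`_m * iter m sigma (q : {poly A})`_n.
Proof.
move=> le_pm le_qn.
have -> : p * q = \sum_(i < m.+1) (p : {poly A})`_i *: iter i (skew_shift D) q.
  exact: skew_mulw.
split.
  apply: (leq_trans (size_sum _ _ _)); apply/bigmax_leqP => i _.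
  rewrite (leq_trans (size_scale_leq _ _)) //.
  have [le_s _] := skew_size_shift_iter i le_qn.
  by rewrite (leq_trans le_s) // ltnS leq_add2l -ltnS.
rewrite coef_sum big_ord_recr /= big1 ?add0r => [|i _].
  by have [_ e] := skew_size_shift_iter m le_qn; rewrite coefZ e.
have [le_s _] := skew_size_shift_iter i le_qn.
rewrite coefZ [X in _ * X]nth_default ?mulr0 //.
by apply: leq_trans le_s _; rewrite ltn_add2l.
Qed.

End SkewPolyTheory.

(** * Ore domains *)

Record ore_domain (R : nzRingType) : Prop := OreDomain {
  ore_mulf_eq0 : forall x y : R, x * y = 0 -> x = 0 \/ y = 0;
  ore_left : forall x y : R, x != 0 -> exists s t, s != 0 /\ s * y = t * x;
  ore_right : forall x y : R, x != 0 -> exists s t, s != 0 /\ y * s = x * t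
}.

Lemma ore_mulf_neq0 (R : nzRingType) (x y : R) :
  ore_domain R -> x != 0 -> y != 0 -> x * y != 0.
Proof.
move=> oreR x0 y0; apply/eqP=> /(ore_mulf_eq0 oreR)[] /eqP.
  exact/negP.
exact/negP.
Qed.

Lemma ore_domain_poly (k : fieldType) : ore_domain {poly k}.
Proof.
split=> [x y /eqP|x y x0|x y x0].
- by rewrite mulf_eq0 => /orP[] /eqP; [left|right].
- by exists x, y; rewrite mulrC.
- by exists x, y; rewrite mulrC.
Qed.

Lemma ore_domain_iso (k : fieldType) (A B : algType k)
    (phi : {lrmorphism A -> B}) :
  bijective phi -> ore_domain B -> ore_domain A.
Proof.
case=> psi phiK psiK oreB.
have phi0 x : phi x = 0 -> x = 0.
  by rewrite -(rmorph0 phi) => /(can_inj phiK).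
have phiN0 x : x != 0 -> phi x != 0.
  by apply: contraNneq => /phi0 ->.
split=> [x y|x y x0|x y x0].
- move=> /(congr1 phi); rewrite rmorphM rmorph0.
  by case/(ore_mulf_eq0 oreB) => /phi0; [left|right].
- have [s [t [s0 e]]] := ore_left oreB (phi y) (phiN0 _ x0).
  exists (psi s), (psi t); split.
    by apply: contraNneq s0 => s0; rewrite -(psiK s) s0 rmorph0.
  by apply: (can_inj phiK); rewrite !rmorphM /= !psiK.
- have [s [t [s0 e]]] := ore_right oreB (phi y) (phiN0 _ x0).
  exists (psi s), (psi t); split.
    by apply: contraNneq s0 => s0; rewrite -(psiK s) s0 rmorph0.
  by apply: (can_inj phiK); rewrite !rmorphM /= !psiK.
Qed.

(** Euclid's algorithm, up to left multiples: the division steps only require a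
    nonzero left multiple of the dividend, and the multipliers accumulated
    along the remainders give the common left multiple of p and q. *)
Lemma euclid_left_ore (R : nzRingType) (deg : R -> nat) :
  (forall x y : R, x * y = 0 -> x = 0 \/ y = 0) ->
  (forall p q : R, p != 0 -> q != 0 -> (deg p <= deg q)%N ->
     exists c h, c != 0 /\ (deg (c * q - h * p)%R < deg q)%N) ->
  forall p q : R, p != 0 -> exists s t, s != 0 /\ s * q = t * p.
Proof.
move=> mulf_eq0 reduce p q.
have mulf_neq0 (x y : R) : x != 0 -> y != 0 -> x * y != 0.
  move=> x0 y0; apply/eqP=> /(mulf_eq0 _ _)[] /eqP; exact/negP.
have [n] := ubnP (deg p + deg q)%N; elim: n p q => // n IHn p q /ltnSE le_pq p0.
have [->|q0] := eqVneq q 0.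
  by exists 1, 0; rewrite mulr0 mul0r oner_neq0.
have [le|lt] := leqP (deg p) (deg q).
  have [c [h [c0 lt]]] := reduce p q p0 q0 le.
  have [|s [t [s0 e]]] := IHn p (c * q - h * p) _ p0.
    by rewrite (leq_trans _ le_pq) // ltn_add2l.
  exists (s * c), (t + s * h); split; first exact: mulf_neq0.
  by move/eqP: e; rewrite mulrBr subr_eq mulrDl !mulrA => /eqP.
have [c [h [c0 lt']]] := reduce q p q0 p0 (ltnW lt).
have [e|r0] := eqVneq (c * p - h * q) 0.
  move/eqP: e; rewrite subr_eq0 => /eqP e; exists h, c; split=> //.
  apply: contraNneq (mulf_neq0 _ _ c0 p0) => h0.
  by rewrite e h0 mul0r.
have [|s [t [s0 e]]] := IHn (c * p - h * q) q _ r0.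
  by rewrite (leq_trans _ le_pq) // ltn_add2r.
have e' : (s + t * h) * q = t * c * p.
  by rewrite mulrDl e; noncomm.
exists (s + t * h), (t * c); split=> //.
apply/eqP=> st0; move: e'; rewrite st0 mul0r => /esym/(mulf_eq0 _ _)[];
  last exact/eqP.
case/(mulf_eq0 _ _) => [t0|]; last exact/eqP.
by move: st0; rewrite t0 mul0r addr0; apply/eqP.
Qed.

Section SkewPolyOre.
Variables (k : fieldType) (A : algType k) (D : skew_data A).
Local Notation sigma := (skew_aut D).
Local Notation M := (skew_poly D).
Local Notation X := (skewX D).
Local Notation C := (skewC D).
Local Notation deg p := (size (p : {poly A})).
Hypothesis oreA : ore_domain A.

Lemma skew_aut_iter_eq0 n r : iter n sigma r = 0 -> r = 0.
Proof.
elim: n => //= n IHn e; apply: IHn; apply: (bij_inj (skew_aut_bij D)).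
by rewrite e rmorph0.
Qed.

Lemma skew_aut_iter_surj n s : exists r, iter n sigma r = s.
Proof.
elim: n s => [|n IHn] s; first by exists s.
have [tau _ tauK] := skew_aut_bij D.
by have [r e] := IHn (tau s); exists r; rewrite /= e tauK.
Qed.

Lemma skew_iter_aut0 n : iter n sigma 0 = 0.
Proof. by elim: n => //= n ->; rewrite rmorph0. Qed.

Lemma skew_domain (p q : M) : p * q = 0 -> p = 0 \/ q = 0.
Proof.
move=> pq0; have [->|p0] := eqVneq p 0; first by left.
have [->|q0] := eqVneq q 0; [by right|].
have sp : (deg p).-1.+1 = deg p by rewrite prednK // size_poly_gt0.
have sq : (deg q).-1.+1 = deg q by rewrite prednK // size_poly_gt0.
have [|| _] := @skew_coefM _ _ D (deg p).-1 (deg q).-1 p q; rewrite ?sp ?sq //.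
rewrite pq0 coef0 => /esym/(ore_mulf_eq0 oreA)[/eqP|/skew_aut_iter_eq0/eqP].
  by rewrite -/(lead_coef (p : {poly A})) lead_coef_eq0 (negPf p0).
by rewrite -/(lead_coef (q : {poly A})) lead_coef_eq0 (negPf q0).
Qed.

Lemma size_leq_coef0 n (p : {poly A}) :
  (size p <= n.+1)%N -> p`_n = 0 -> (size p <= n)%N.
Proof.
move=> le_pn pn0; apply/leq_sizeP => j; rewrite leq_eqVlt => /predU1P[<- //|lt].
by rewrite nth_default // (leq_trans le_pn).
Qed.

Lemma size_subr_coef n (p q : {poly A}) :
  (size p <= n.+1)%N -> (size q <= n.+1)%N -> p`_n = q`_n ->
  (size (p - q)%R <= n)%N.
Proof.
move=> le_p le_q e; apply: size_leq_coef0; last by rewrite coefB e subrr.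
by rewrite (leq_trans (size_polyD _ _)) // size_polyN geq_max le_p.
Qed.

(** Pseudo-division: the Ore condition in A makes the leading terms of a
    multiple of q and of a multiple of p agree. *)
Lemma skew_reduce_left (p q : M) : p != 0 -> q != 0 -> (deg p <= deg q)%N ->
  exists c h : M, c != 0 /\ (deg (c * q - h * p)%R < deg q)%N.
Proof.
move=> p0 q0 le_pq.
have sp : deg p = (deg p).-1.+1 by rewrite prednK // size_poly_gt0.
have sq : deg q = (deg q).-1.+1 by rewrite prednK // size_poly_gt0.
set m := (deg p).-1 in sp; set n := (deg q).-1 in sq.
have le_mn : (m <= n)%N by rewrite -ltnS -sp -sq.
have x0 : iter (n - m) sigma (p : {poly A})`_m != 0.
  apply: contra_neq (_ : lead_coef (p : {poly A}) != 0);
    last by rewrite lead_coef_eq0.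
  exact: skew_aut_iter_eq0.
have [s [t [s0 e]]] := ore_left oreA (q : {poly A})`_n x0.
exists (C s), (C t * X ^+ (n - m)); split; first by rewrite polyC_eq0.
rewrite sq ltnS.
have [|| sz1 c1] := @skew_coefM _ _ D 0 n (C s) q; rewrite ?sq //.
  exact: size_polyC_leq1.
have eh : C t * X ^+ (n - m) = (t *: 'X^(n - m) : {poly A}).
  by rewrite skewCM_scale skewXnE.
have [|| sz2 c2] := @skew_coefM _ _ D (n - m) m (C t * X ^+ (n - m)) p.
- by rewrite eh (leq_trans (size_scale_leq _ _)) // size_polyXn.
- by rewrite sp.
rewrite addn0 in sz1 c1; rewrite subnKC // in sz2 c2.
apply: size_subr_coef => //; rewrite c1 c2 coefC /= e.
by rewrite eh coefZ coefXn eqxx mulr1.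
Qed.

(** With coefficients on the left, the right-hand version has to move scalars
    through powers of x; this is where sigma must be surjective. *)
Lemma skew_reduce_right (p q : M) : p != 0 -> q != 0 -> (deg p <= deg q)%N ->
  exists c h : M, c != 0 /\ (deg (q * c - p * h)%R < deg q)%N.
Proof.
move=> p0 q0 le_pq.
have sp : deg p = (deg p).-1.+1 by rewrite prednK // size_poly_gt0.
have sq : deg q = (deg q).-1.+1 by rewrite prednK // size_poly_gt0.
set m := (deg p).-1 in sp; set n := (deg q).-1 in sq.
have le_mn : (m <= n)%N by rewrite -ltnS -sp -sq.
have x0 : (p : {poly A})`_m != 0.
  by rewrite -/(lead_coef (p : {poly A})) lead_coef_eq0.
have [s' [t' [s0 e]]] := ore_right oreA (q : {poly A})`_n x0.
have [s es] := skew_aut_iter_surj n s'; have [t et] := skew_aut_iter_surj n t'.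
exists (C s), (X ^+ (n - m) * C t); split.
  rewrite polyC_eq0; apply: contraNneq s0 => s0.
  by rewrite -es s0 skew_iter_aut0.
rewrite sq ltnS.
have [|| sz1 c1] := @skew_coefM _ _ D n 0 q (C s); rewrite ?sq //.
  exact: size_polyC_leq1.
have [|| szh ch] := @skew_coefM _ _ D (n - m) 0 (X ^+ (n - m)) (C t).
- by rewrite skewXnE size_polyXn.
- exact: size_polyC_leq1.
rewrite add0n in sz1 c1 szh ch.
have [|| sz2 c2] := @skew_coefM _ _ D m (n - m) p (X ^+ (n - m) * C t) => //.
  by rewrite sp.
rewrite subnK // in sz2 c2.
apply: size_subr_coef => //; rewrite c1 c2 coefC /= es e ch skewXnE coefXn eqxx.
by rewrite mul1r coefC /= -iterD subnKC // et.
Qed.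

(** Both conditions come from Euclid's algorithm, the right one in the converse
    ring. *)
Lemma ore_domain_skew : ore_domain M.
Proof.
split; first exact: skew_domain.
  exact: (@euclid_left_ore M (fun p => deg p) skew_domain skew_reduce_left).
apply: (@euclid_left_ore (M^c)%type (fun p => deg p)) => [x y|].
  by move=> /skew_domain[]; [right|left].
exact: skew_reduce_right.
Qed.

End SkewPolyOre.

(** * P(f,g) as an iterated skew polynomial ring *)

Lemma horner_lrmorphism (k : fieldType) (A : algType k) (x : A) :
  exists phi : {lrmorphism {poly k} -> A}, phi =1 horner_alg x.
Proof.
apply: lrmorphism_ex => [p q|p q||c p]; rewrite ?rmorphD ?rmorphM ?rmorph1 //.
by rewrite -mul_polyC horner_algM horner_algC mulr_algl.
Qed.

Section IteratedModel.
Variables (k : fieldType) (f g : {poly k}).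
Local Notation P := (Palg f g).
Local Notation D1 := (P_model_data f).
Local Notation B1 := (skew_poly D1).
Local Notation C1 := (skewC D1).
Local Notation X1 := (skewX D1).

Lemma skewC_horner (A : algType k) (D : skew_data A) (x : A) p :
  skewC D (horner_alg x p) = horner_alg (skewC D x) p.
Proof. exact: (lrmorph_horner_alg (skewC D)). Qed.

Lemma model_shift (h : {poly k}) :
  exists phi : {lrmorphism B1 -> B1},
    (forall r, phi (C1 r) = C1 r) /\ phi X1 = X1 + C1 h.
Proof.
apply: (@skew_hom _ _ D1 _ (skewC D1 : {lrmorphism {poly k} -> B1})) => r /=.
by rewrite mulrDl mulrDr skewX_mulC -!rmorphM /= [h * r]mulrC; noncomm.
Qed.

(** The relation u a = (a - g) u says that u is adjoined to k[c][a; f d/dc] by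
    the automorphism shifting a by -g, with derivation zero. *)
Lemma model_twist_ex : exists D2 : skew_data B1,
  [/\ forall r, skew_aut D2 (C1 r) = C1 r, skew_aut D2 X1 = X1 - C1 g
    & forall x, skew_der D2 x = 0].
Proof.
have [phi [phiC phiX]] := model_shift (- g).
have [psi [psiC psiX]] := model_shift g.
have bij_phi : bijective phi.
  exists psi => x.
    apply: (@skew_hom_ext _ _ _ _ (psi \o phi : {lrmorphism B1 -> B1}) idfun).
      by move=> r /=; rewrite phiC psiC.
    by rewrite /= phiX rmorphD /= psiX psiC rmorphN; noncomm.
  apply: (@skew_hom_ext _ _ _ _ (phi \o psi : {lrmorphism B1 -> B1}) idfun).
    by move=> r /=; rewrite psiC phiC.
  by rewrite /= psiX rmorphD /= phiX phiC rmorphN; noncomm.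
have der0 (r s : B1) : (\0 : {linear B1 -> B1}) (r * s)
    = phi r * (\0 : {linear B1 -> B1}) s + (\0 : {linear B1 -> B1}) r * s.
  by rewrite /= mulr0 mul0r addr0.
exists (SkewData bij_phi der0); split=> //=.
by rewrite phiX rmorphN.
Qed.

(** P(f,g) is k[c][a; f d/dc][u; sigma]: the two universal properties give
    inverse homomorphisms. Hence P(f,g) is an Ore domain containing k[c]. *)
Lemma P_model : exists (D2 : skew_data B1) (phi : {lrmorphism P -> skew_poly D2}),
  bijective phi /\ forall p, phi (P_poly f g p) = skewC D2 (C1 p).
Proof.
have [D2 [autC autX der0]] := model_twist_ex.
exists D2; pose C2 := skewC D2; pose X2 := skewX D2.
have hornerC1 p : horner_alg (C1 'X) p = C1 p.
  by rewrite -skewC_horner horner_alg_polyX.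
have hornerC2 p : horner_alg (C2 (C1 'X)) p = C2 (C1 p).
  by rewrite -skewC_horner hornerC1.
have [|||phi [phia phic phiu]] :=
    @P_hom k f g (skew_poly D2) (C2 X1) (C2 (C1 'X)) X2.
- rewrite hornerC2 -!rmorphM -rmorphD /= skewX_mulC /=.
  by rewrite /P_model_der derivX mulr1.
- by rewrite skewX_mulC autC der0 rmorph0 addr0.
- rewrite hornerC2 skewX_mulC autX der0 rmorph0 addr0 rmorphB /=.
  by noncomm.
have [hc hcE] := horner_lrmorphism (P_c f g).
have [|psi1 [psi1C psi1X]] := @skew_hom _ _ D1 P hc (P_a f g).
  by move=> r; rewrite !hcE; apply/horner_alg_der/P_ac.
have {}psi1C r : psi1 (C1 r) = P_poly f g r by rewrite psi1C hcE.
have u_psi1 : forall r, P_u f g * psi1 r = psi1 (skew_aut D2 r) * P_u f g.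
  apply: skew_ind => [|r|].
  - split=> [|x y ex ey|x y ex ey|c x ex].
    + by rewrite !rmorph1 mulr1 mul1r.
    + rewrite !rmorphD /= mulrDr [RHS]mulrDl; congr (_ + _); [exact: ex|exact: ey].
    + by rewrite !rmorphM /= mulrA ex -!mulrA ey.
    + rewrite !linearZ /= -[LHS]scalerAr -[RHS]scalerAl; congr (_ *: _).
      exact: ex.
  - by rewrite autC psi1C; apply/horner_alg_comm/P_uc.
  - rewrite autX rmorphB /= psi1C !psi1X  [RHS]mulrBl P_au.
    by noncomm.
have [|psi [psiC psiX]] := @skew_hom _ _ D2 P psi1 (P_u f g).
  by move=> r; rewrite der0 rmorph0 addr0.
exists phi; split=> [|p]; last by rewrite lrmorph_horner_alg phic hornerC2.
exists psi => x.
  apply: (@P_hom_ext _ _ _ _ (psi \o phi : {lrmorphism P -> P}) idfun) => /=.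
  - by rewrite phia psiC psi1X.
  - by rewrite phic psiC psi1C /P_poly horner_algX.
  - by rewrite phiu psiX.
apply: (@skew_hom_ext _ _ _ _
  (phi \o psi : {lrmorphism skew_poly D2 -> skew_poly D2}) idfun) => /=.
  move=> r; rewrite psiC.
  apply: (@skew_hom_ext _ _ _ _ (phi \o psi1 : {lrmorphism B1 -> skew_poly D2})
    (skewC D2)) => /= [p|]; last by rewrite psi1X phia.
  by rewrite psi1C /= lrmorph_horner_alg phic hornerC2.
by rewrite psiX phiu.
Qed.

Lemma ore_domain_P : ore_domain P.
Proof.
have [D2 [phi [phi_bij _]]] := P_model.
apply: (ore_domain_iso phi_bij); do 2 apply: ore_domain_skew.
exact: ore_domain_poly.
Qed.

Lemma P_poly_eq0 p : P_poly f g p = 0 -> p = 0.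
Proof.
have [D2 [phi [_ phi_poly]]] := P_model.
move=> /(congr1 phi); rewrite phi_poly rmorph0 => /polyC_inj/polyC_inj //.
Qed.

End IteratedModel.

(** * Ore localization *)

Record ore_set (R : nzRingType) (S : R -> Prop) : Prop := OreSet {
  ore_set1 : S 1;
  ore_setM : forall s t, S s -> S t -> S (s * t);
  ore_set_lreg : forall s x, S s -> s * x = 0 -> x = 0;
  ore_set_rreg : forall s x, S s -> x * s = 0 -> x = 0;
  ore_set_left : forall r s, S s -> exists t x, S t /\ t * r = x * s;
  ore_set_right : forall r s, S s -> exists t x, S t /\ r * t = s * x
}.

(** The ring of fractions is realized by partial endomorphisms: a fraction q is
    the map x |-> q x, which is defined on the right ideal of the x such that q
    x lies in R. So its elements are the maps R -> R that are right linear on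
    some right ideal meeting r S for every r, two maps being identified when
    they agree on such an ideal. Products are compositions, so that most ring
    axioms hold on the nose, and the inverse of s in S is the map s x |-> x,
    whose domain is dense by the right Ore condition. *)
Section OreLocalization.
Local Open Scope quotient_scope.
Variables (k : fieldType) (R : algType k) (S : R -> Prop).
Hypothesis oreS : ore_set S.

Record dense_ideal (I : R -> Prop) : Prop := DenseIdeal {
  dense_idealD : forall x y, I x -> I y -> I (x + y);
  dense_idealM : forall x r, I x -> I (x * r);
  dense_ideal_dense : forall r, exists2 t, S t & I (r * t)
}.

Lemma dense_idealT : dense_ideal (fun _ => True).
Proof. by split=> // r; exists 1 => //; apply: (ore_set1 oreS). Qed.

Lemma dense_idealI I J :
  dense_ideal I -> dense_ideal J -> dense_ideal (fun x => I x /\ J x).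
Proof.
move=> dI dJ; split=> [x y [Ix Jx] [Iy Jy]|x r [Ix Jx]|r].
- by split; apply: dense_idealD.
- by split; apply: dense_idealM.
have [t St It] := dense_ideal_dense dI r.
have [t' St' Jt'] := dense_ideal_dense dJ (r * t).
exists (t * t'); first exact: (ore_setM oreS).
by rewrite mulrA; split=> //; apply: dense_idealM.
Qed.

(** Values outside the domain of linearity are irrelevant, which lets maps be
    total. *)
Definition linear_on (I : R -> Prop) (phi : R -> R) : Prop :=
  (forall x y, I x -> I y -> phi (x + y) = phi x + phi y) /\
  (forall x r, I x -> phi (x * r) = phi x * r).

Record pfun := Pfun {
  pfun_val :> R -> R;
  pfunP : exists2 I, dense_ideal I & linear_on I pfun_val
}.

Lemma dense_ideal_preim I J phi :
  dense_ideal I -> dense_ideal J -> linear_on J phi ->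
  dense_ideal (fun x => J x /\ I (phi x)).
Proof.
move=> dI dJ [phiD phiM]; split=> [x y [Jx Ix] [Jy Iy]|x r [Jx Ix]|r].
- by split; [|rewrite phiD //]; apply: dense_idealD.
- by split; [|rewrite phiM //]; apply: dense_idealM.
have [t St Jt] := dense_ideal_dense dJ r.
have [t' St' It'] := dense_ideal_dense dI (phi (r * t)).
exists (t * t'); first exact: (ore_setM oreS).
by rewrite mulrA; split; [apply: dense_idealM | rewrite phiM].
Qed.

HB.instance Definition _ := gen_eqMixin pfun.
HB.instance Definition _ := gen_choiceMixin pfun.

Definition agree (phi psi : R -> R) : Prop :=
  exists2 I, dense_ideal I & forall x, I x -> phi x = psi x.

Lemma agree_refl phi : agree phi phi.
Proof. by exists (fun _ => True) => //; apply: dense_idealT. Qed.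

Lemma agree_ext phi psi : phi =1 psi -> agree phi psi.
Proof. by move=> e; exists (fun _ => True) => //; apply: dense_idealT. Qed.

Lemma agree_sym phi psi : agree phi psi -> agree psi phi.
Proof. by case=> I dI e; exists I => // x Ix; rewrite e. Qed.

Lemma agree_trans phi psi chi : agree phi psi -> agree psi chi -> agree phi chi.
Proof.
case=> I dI e [J dJ e']; exists (fun x => I x /\ J x); first exact: dense_idealI.
by move=> x [Ix Jx]; rewrite e ?e'.
Qed.

Definition pfun_equiv (phi psi : pfun) : bool := `[< agree phi psi >].

Lemma pfun_equiv_class : equiv_class_of pfun_equiv.
Proof.
split=> [phi|phi psi|psi phi chi].
- exact/asboolP/agree_refl.
- by apply/asboolP/asboolP; apply: agree_sym.
- by move=> /asboolP h1 /asboolP h2; apply/asboolP; apply: agree_trans h2.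
Qed.

Canonical pfun_equiv_rel := EquivRelPack pfun_equiv_class.

Definition frac : Type := {eq_quot pfun_equiv}.
HB.instance Definition _ := Choice.copy frac {eq_quot pfun_equiv}.

Definition frac_pi (phi : pfun) : frac := \pi_{eq_quot pfun_equiv} phi.
Definition frac_repr (q : frac) : pfun := repr (q : {eq_quot pfun_equiv}).

Lemma frac_reprK q : frac_pi (frac_repr q) = q. Proof. exact: reprK. Qed.

Lemma frac_piE phi psi : frac_pi phi = frac_pi psi <-> agree phi psi.
Proof.
split=> [/eqquotP/asboolP //|h].
exact/eqquotP/asboolP.
Qed.

Lemma frac_repr_pi phi : agree (frac_repr (frac_pi phi)) phi.
Proof. by apply/frac_piE; rewrite frac_reprK. Qed.

Lemma frac_ind (Pr : frac -> Prop) :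
  (forall phi, Pr (frac_pi phi)) -> forall q, Pr q.
Proof. by move=> PF q; rewrite -[q]frac_reprK. Qed.

Fact pfun_add_proof (phi psi : pfun) :
  exists2 I, dense_ideal I & linear_on I (fun x => phi x + psi x).
Proof.
case: phi psi => [phi [I dI [phiD phiM]]] [psi [J dJ [psiD psiM]]] /=.
exists (fun x => I x /\ J x); first exact: dense_idealI.
split=> [x y [Ix Jx] [Iy Jy]|x r [Ix Jx]].
  by rewrite phiD ?psiD // addrACA.
by rewrite phiM ?psiM // mulrDl.
Qed.
Definition pfun_add phi psi := Pfun (pfun_add_proof phi psi).

Fact pfun_comp_proof (phi psi : pfun) :
  exists2 I, dense_ideal I & linear_on I (fun x => phi (psi x)).
Proof.
case: phi psi => [phi [I dI [phiD phiM]]] [psi [J dJ psiL]] /=.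
exists (fun x => J x /\ I (psi x)); first exact: dense_ideal_preim.
case: psiL => psiD psiM; split=> [x y [Ix Jx] [Iy Jy]|x r [Ix Jx]].
  by rewrite psiD ?phiD.
by rewrite psiM ?phiM.
Qed.
Definition pfun_comp phi psi := Pfun (pfun_comp_proof phi psi).

Fact pfun_mull_proof (r : R) :
  exists2 I, dense_ideal I & linear_on I (fun x => r * x).
Proof.
exists (fun _ => True); first exact: dense_idealT.
by split=> [x y _ _|x s _]; rewrite ?mulrDr ?mulrA.
Qed.
Definition pfun_mull r := Pfun (pfun_mull_proof r).

Definition frac_add (p q : frac) : frac :=
  frac_pi (pfun_add (frac_repr p) (frac_repr q)).
Definition frac_mul (p q : frac) : frac :=
  frac_pi (pfun_comp (frac_repr p) (frac_repr q)).
Definition frac_iota (r : R) : frac := frac_pi (pfun_mull r).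
Definition frac_opp (p : frac) : frac := frac_mul (frac_iota (-1)) p.
Definition frac_scale (a : k) (p : frac) : frac := frac_mul (frac_iota a%:A) p.

Lemma frac_piD phi psi :
  frac_add (frac_pi phi) (frac_pi psi) = frac_pi (pfun_add phi psi).
Proof.
apply/frac_piE => /=.
have [I dI eI] := frac_repr_pi phi; have [J dJ eJ] := frac_repr_pi psi.
exists (fun x => I x /\ J x); first exact: dense_idealI.
by move=> x [Ix Jx]; rewrite eI ?eJ.
Qed.

Lemma frac_piM phi psi :
  frac_mul (frac_pi phi) (frac_pi psi) = frac_pi (pfun_comp phi psi).
Proof.
apply/frac_piE => /=.
have [I dI eI] := frac_repr_pi phi; have [J dJ eJ] := frac_repr_pi psi.
have [K dK psiL] := pfunP psi.
exists (fun x => J x /\ (K x /\ I (psi x))).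
  by apply: dense_idealI => //; apply: dense_ideal_preim.
by move=> x [Jx [_ Ix]]; rewrite eJ ?eI.
Qed.

Lemma frac_addA : associative frac_add.
Proof.
elim/frac_ind=> p; elim/frac_ind=> q; elim/frac_ind=> r.
by rewrite !frac_piD; apply/frac_piE/agree_ext => x; apply: addrA.
Qed.

Lemma frac_addC : commutative frac_add.
Proof.
elim/frac_ind=> p; elim/frac_ind=> q.
by rewrite !frac_piD; apply/frac_piE/agree_ext => x; apply: addrC.
Qed.

Lemma frac_add0 : left_id (frac_iota 0) frac_add.
Proof.
elim/frac_ind=> p; rewrite frac_piD.
by apply/frac_piE/agree_ext => x; rewrite /= mul0r add0r.
Qed.

Lemma frac_addN : left_inverse (frac_iota 0) frac_opp frac_add.
Proof.
elim/frac_ind=> p; rewrite /frac_opp frac_piM frac_piD.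
by apply/frac_piE/agree_ext => x; rewrite /= mulN1r addNr mul0r.
Qed.

HB.instance Definition _ :=
  GRing.isZmodule.Build frac frac_addA frac_addC frac_add0 frac_addN.

Lemma frac_mulA : associative frac_mul.
Proof.
elim/frac_ind=> p; elim/frac_ind=> q; elim/frac_ind=> r.
by rewrite !frac_piM; apply/frac_piE/agree_ext.
Qed.

Lemma frac_mul1l : left_id (frac_iota 1) frac_mul.
Proof.
elim/frac_ind=> p; rewrite frac_piM.
by apply/frac_piE/agree_ext => x; rewrite /= mul1r.
Qed.

Lemma frac_mul1r : right_id (frac_iota 1) frac_mul.
Proof.
elim/frac_ind=> p; rewrite frac_piM.
by apply/frac_piE/agree_ext => x; rewrite /= mul1r.
Qed.

Lemma frac_mulDl : left_distributive frac_mul +%R.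
Proof.
elim/frac_ind=> p; elim/frac_ind=> q; elim/frac_ind=> r.
by rewrite /GRing.add /= !(frac_piM, frac_piD); apply/frac_piE/agree_ext.
Qed.

Lemma frac_mulDr : right_distributive frac_mul +%R.
Proof.
elim/frac_ind=> p; elim/frac_ind=> q; elim/frac_ind=> r.
rewrite /GRing.add /= !(frac_piM, frac_piD); apply/frac_piE => /=.
have [I dI [pD _]] := pfunP p.
have [J dJ qL] := pfunP q; have [K dK rL] := pfunP r.
exists (fun x => (J x /\ I (q x)) /\ (K x /\ I (r x))).
  by apply: dense_idealI; apply: dense_ideal_preim.
by move=> x [[_ Ix] [_ Ix']]; apply: pD.
Qed.

Lemma frac_iota_inj : injective frac_iota.
Proof.
move=> r s /frac_piE[I dI] /= e; apply/eqP; rewrite -subr_eq0; apply/eqP.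
have [t St It] := dense_ideal_dense dI 1; rewrite mul1r in It.
by apply: (ore_set_rreg oreS St); rewrite mulrBl e // subrr.
Qed.

Lemma frac_oner_neq0 : frac_iota 1 != 0.
Proof. by apply/eqP=> /frac_iota_inj/eqP; rewrite oner_eq0. Qed.

HB.instance Definition _ := GRing.Zmodule_isNzRing.Build frac
  frac_mulA frac_mul1l frac_mul1r frac_mulDl frac_mulDr frac_oner_neq0.

Lemma frac_iotaD : {morph frac_iota : r s / r + s}.
Proof.
move=> r s; rewrite [RHS]frac_piD.
by apply/frac_piE/agree_ext => x; rewrite /= mulrDl.
Qed.

Lemma frac_iotaM : {morph frac_iota : r s / r * s}.
Proof.
move=> r s; rewrite [RHS]frac_piM.
by apply/frac_piE/agree_ext => x; rewrite /= mulrA.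
Qed.

Lemma frac_scaleA a b p : frac_scale a (frac_scale b p) = frac_scale (a * b) p.
Proof.
rewrite /frac_scale frac_mulA -[frac_mul (frac_iota _) _]frac_iotaM.
by rewrite mulr_algl scalerA.
Qed.

Lemma frac_scale1 : left_id 1 frac_scale.
Proof. by move=> p; rewrite /frac_scale scale1r frac_mul1l. Qed.

Lemma frac_scaleDr : right_distributive frac_scale +%R.
Proof. by move=> a p q; apply: frac_mulDr. Qed.

Lemma frac_scaleDl p : {morph frac_scale^~ p : a b / a + b}.
Proof. by move=> a b; rewrite /frac_scale scalerDl frac_iotaD frac_mulDl. Qed.

HB.instance Definition _ := GRing.Zmodule_isLmodule.Build k frac
  frac_scaleA frac_scale1 frac_scaleDr frac_scaleDl.

Lemma frac_scaleAl a (p q : frac) : a *: (p * q) = (a *: p) * q.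
Proof. exact: frac_mulA. Qed.

HB.instance Definition _ := GRing.Lmodule_isLalgebra.Build k frac frac_scaleAl.

Lemma frac_scaleAr a (p q : frac) : a *: (p * q) = p * (a *: q).
Proof.
move: p q; elim/frac_ind=> p; elim/frac_ind=> q.
rewrite -[LHS]/(frac_mul (frac_iota a%:A) (frac_mul (frac_pi p) (frac_pi q))).
rewrite -[RHS]/(frac_mul (frac_pi p) (frac_mul (frac_iota a%:A) (frac_pi q))).
rewrite (frac_piM (pfun_mull a%:A) q) !frac_piM; apply/frac_piE => /=.
have [I dI [_ pM]] := pfunP p; have [J dJ qL] := pfunP q.
exists (fun x => J x /\ I (q x)); first exact: dense_ideal_preim.
by move=> x [_ Ix]; rewrite mulr_algl -mulr_algr -pM // mulr_algl mulr_algr.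
Qed.

HB.instance Definition _ := GRing.Lalgebra_isAlgebra.Build k frac frac_scaleAr.

(** Invertibility is not decidable here, so units and inverses are obtained
    from excluded middle and choice. *)
Definition frac_unit : pred frac :=
  fun p => `[< exists q, q * p = 1 /\ p * q = 1 >].
Definition frac_inv (p : frac) : frac :=
  if pselect (exists q, q * p = 1 /\ p * q = 1) is left h
  then projT1 (cid h) else p.

Lemma frac_invP p : p \in frac_unit -> frac_inv p * p = 1 /\ p * frac_inv p = 1.
Proof.
move=> /asboolP h; rewrite /frac_inv; case: pselect => // h'.
by case: cid.
Qed.

Fact frac_mulVr : {in frac_unit, left_inverse 1 frac_inv *%R}.
Proof. by move=> p /frac_invP[]. Qed.
Fact frac_mulrV : {in frac_unit, right_inverse 1 frac_inv *%R}.
Proof. by move=> p /frac_invP[]. Qed.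
Fact frac_unitP (p q : frac) : q * p = 1 /\ p * q = 1 -> frac_unit p.
Proof. by move=> h; apply/asboolP; exists q. Qed.
Fact frac_inv_out : {in [predC frac_unit], frac_inv =1 id}.
Proof.
move=> p; rewrite inE => /asboolP h; rewrite /frac_inv.
by case: pselect.
Qed.

HB.instance Definition _ := GRing.NzRing_hasMulInverse.Build frac
  frac_mulVr frac_mulrV frac_unitP frac_inv_out.

Lemma frac_iota_unit s : S s -> frac_iota s \is a GRing.unit.
Proof.
move=> Ss; have lreg_s x y : s * x = s * y -> x = y.
  move=> e; apply/eqP; rewrite -subr_eq0; apply/eqP.
  by apply: (ore_set_lreg oreS Ss); rewrite mulrBr e subrr.
pose J x := exists y, x = s * y.
have dJ : dense_ideal J.
  split=> [x y [x' ->] [y' ->]|x r [x' ->]|r].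
  - by exists (x' + y'); rewrite mulrDr.
  - by exists (x' * r); rewrite mulrA.
  - by have [t [x [St e]]] := ore_set_right oreS r Ss; exists t => //; exists x.
pose phi x := if pselect (J x) is left h then projT1 (cid h) else 0.
have phiK x : phi (s * x) = x.
  rewrite /phi; case: pselect => [h|[]]; last by exists x.
  by case: cid => y /= /lreg_s.
have phiP : exists2 I, dense_ideal I & linear_on I phi.
  exists J => //; split=> [_ _ [x ->] [y ->]|_ r [x ->]].
    by rewrite -mulrDr !phiK.
  by rewrite -mulrA !phiK.
apply/asboolP; exists (frac_pi (Pfun phiP)); split.
  by rewrite [LHS]frac_piM; apply/frac_piE/agree_ext => x /=; rewrite phiK mul1r.
rewrite [LHS]frac_piM; apply/frac_piE; exists J => // _ [x ->] /=.
by rewrite phiK mul1r.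
Qed.

(** A partial map p defined at some s in S is the fraction p(s) / s, because p
    (s x) = p(s) x. *)
Lemma frac_right_fraction p : exists s r, S s /\ p * frac_iota s = frac_iota r.
Proof.
elim/frac_ind: p => p; have [I dI [_ pM]] := pfunP p.
have [s Ss Is] := dense_ideal_dense dI 1; rewrite mul1r in Is.
exists s, (p s); split=> //; rewrite [LHS]frac_piM.
by apply/frac_piE/agree_ext => x /=; rewrite pM.
Qed.

Lemma frac_iota_lrmorphism : exists iota : {lrmorphism R -> frac}, iota =1 frac_iota.
Proof.
apply: lrmorphism_ex => [||//|a r]; [exact: frac_iotaD|exact: frac_iotaM|].
by rewrite -mulr_algl frac_iotaM.
Qed.

End OreLocalization.

(** The left Ore condition is what turns the right fractions r / s into left
    ones. *)
Lemma ore_localization (k : fieldType) (R : algType k) (S : R -> Prop) :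
  ore_set S ->
  exists (Q : unitAlgType k) (iota : {lrmorphism R -> Q}),
    is_fraction_ring S iota.
Proof.
move=> oreS; have [iota iotaE] := frac_iota_lrmorphism oreS.
have iotaU s : S s -> iota s \is a GRing.unit.
  by move=> Ss; rewrite iotaE; apply: frac_iota_unit.
have iota0 r : iota r = 0 -> r = 0.
  rewrite iotaE => r0; apply: (@frac_iota_inj _ _ _ oreS r 0); exact: r0.
have right_frac q : exists s r, S s /\ q = iota r / iota s.
  have [s [r [Ss e]]] := frac_right_fraction (oreS := oreS) q.
  by exists s, r; split=> //; rewrite -(mulrK (iotaU s Ss) q) !iotaE e.
exists (frac oreS), iota; split=> // [q|r].
  have [s [r [Ss ->]]] := right_frac q.
  have [t [x [St e]]] := ore_set_left oreS r Ss.
  exists t, x; split=> //; apply: (canRL (mulKr (iotaU t St))).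
  by rewrite mulrA -rmorphM e rmorphM mulrK //; apply: iotaU.
split; split=> [/iota0 ->|[s Ss e]].
- by exists 1; [apply: (ore_set1 oreS)|rewrite mulr0].
- by rewrite (ore_set_lreg oreS Ss e) rmorph0.
- by exists 1; [apply: (ore_set1 oreS)|rewrite mul0r].
- by rewrite (ore_set_rreg oreS Ss e) rmorph0.
Qed.

(** * Denominators in k[c] *)

Section LeftOre.
Variables (R : nzRingType) (T : R -> Prop).
Hypothesis TM : forall s t, T s -> T t -> T (s * t).
Hypothesis TC : forall s t, T s -> T t -> s * t = t * s.

(** The left Ore condition for a single numerator. For a commutative
    multiplicative set T the elements satisfying it form a subring, so it can
    be checked on generators. *)
Definition left_ore_at (r : R) : Prop :=
  forall s, T s -> exists t x, T t /\ t * r = x * s.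

Lemma left_ore_at_comm r : (forall s, T s -> r * s = s * r) -> left_ore_at r.
Proof. by move=> rs s Ts; exists s, r; rewrite rs. Qed.

Lemma left_ore_atD r1 r2 : left_ore_at r1 -> left_ore_at r2 -> left_ore_at (r1 + r2).
Proof.
move=> h1 h2 s Ts; have [t1 [x1 [T1' e1]]] := h1 s Ts.
have [t2 [x2 [T2' e2]]] := h2 s Ts.
exists (t1 * t2), (t2 * x1 + t1 * x2); split; first exact: TM.
by rewrite mulrDr {1}(TC T1' T2') -!mulrA e1 e2 mulrDl !mulrA.
Qed.

Lemma left_ore_atM r1 r2 : left_ore_at r1 -> left_ore_at r2 -> left_ore_at (r1 * r2).
Proof.
move=> h1 h2 s Ts; have [t2 [x2 [T2' e2]]] := h2 s Ts.
have [t1 [x1 [T1' e1]]] := h1 t2 T2'.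
by exists t1, (x1 * x2); split=> //; rewrite mulrA e1 -mulrA e2 mulrA.
Qed.

Lemma left_ore_at_T s : T s -> left_ore_at s.
Proof. by move=> Ts; apply: left_ore_at_comm => t Tt; apply: TC. Qed.

(** If d = r s - s r satisfies the condition, so does r: squaring s gives s s r
    = r s s - s d - d s, and t s d = y s for suitable t in T and y. *)
Lemma left_ore_at_commutator r :
  (forall s, T s -> left_ore_at (r * s - s * r)) -> left_ore_at r.
Proof.
move=> h s Ts; set d := r * s - s * r.
have [t [y [Tt e]]] := left_ore_atM (left_ore_at_T Ts) (h s Ts) Ts.
rewrite -/d in e; exists (t * (s * s)), (t * r * s - y - t * d).
split; first by do 2?apply: TM.
by rewrite !mulrBl -e /d; noncomm.
Qed.

End LeftOre.

(** The values p(c) for p in F; for the denominators needed here, F is either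
    the set of nonzero polynomials or that of products of irreducible factors
    of f. *)
Definition poly_values (k : fieldType) (A : algType k) (c : A)
  (F : {poly k} -> Prop) (s : A) : Prop := exists2 p, F p & s = horner_alg c p.

Section PolyValues.
Variables (k : fieldType) (F : {poly k} -> Prop).
Hypothesis F1 : F 1.
Hypothesis FM : forall p q, F p -> F q -> F (p * q).

Section Algebra.
Variables (A : algType k) (c : A).
Local Notation T := (poly_values c F).

Lemma poly_values1 : T 1.
Proof. by exists 1 => //; rewrite rmorph1. Qed.

Lemma poly_valuesM s t : T s -> T t -> T (s * t).
Proof.
by move=> [p Fp ->] [q Fq ->]; exists (p * q); [exact: FM|rewrite horner_algM].
Qed.

Lemma poly_valuesC s t : T s -> T t -> s * t = t * s.
Proof. by move=> [p _ ->] [q _ ->]; apply: horner_alg_mulC. Qed.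

Lemma left_ore_at_subalgebra : subalgebra (left_ore_at T).
Proof.
split=> [|x y|x y|a x hx].
- by apply: left_ore_at_comm => s _; rewrite mul1r mulr1.
- exact: (left_ore_atD poly_valuesM poly_valuesC).
- exact: left_ore_atM.
- rewrite -mulr_algl; apply: left_ore_atM hx.
  by apply: left_ore_at_comm => s _; rewrite mulr_algl mulr_algr.
Qed.

Lemma right_ore_at_subalgebra : subalgebra (left_ore_at (R := A^c) T).
Proof.
have TM s t : T s -> T t -> T (t * s) by move=> Ts Tt; apply: poly_valuesM.
have TC s t : T s -> T t -> t * s = s * t by move=> Ts Tt; apply: poly_valuesC.
split=> [|x y|x y hx hy|a x hx].
- by apply: left_ore_at_comm => s _; rewrite mul1r mulr1.
- exact: (@left_ore_atD A^c T TM TC).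
- exact: (@left_ore_atM A^c T _ _ hy hx).
- rewrite -mulr_algl; apply: (@left_ore_atM A^c T _ _ hx).
  apply: left_ore_at_comm => s _.
  by rewrite -[LHS]/((s : A) * a%:A) -[RHS]/(a%:A * (s : A)) mulr_algl mulr_algr.
Qed.

End Algebra.

Lemma left_ore_at_morph (A B : algType k) (phi : {lrmorphism A -> B}) (c : A) r :
  left_ore_at (poly_values c F) r -> left_ore_at (poly_values (phi c) F) (phi r).
Proof.
move=> h _ [p Fp ->]; have [|t [x [[q Fq ->] e]]] := h (horner_alg c p).
  by exists p.
exists (horner_alg (phi c) q), (phi x); split; first by exists q.
by rewrite -!lrmorph_horner_alg -!rmorphM e.
Qed.

Section P.
Variables (f g : {poly k}).
Local Notation P := (Palg f g).
Local Notation T := (poly_values (P_c f g) F).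

Lemma P_a_commutator s : T s ->
  exists q, P_a f g * s - s * P_a f g = P_poly f g q.
Proof.
move=> [p _ ->]; exists (f * p^`()).
by rewrite (horner_alg_der p (P_ac f g)) /P_poly addrC addKr.
Qed.

(** The commutators of a with k[c] lie in k[c]; c and u commute with k[c]. *)
Lemma left_ore_at_P (r : P) : left_ore_at T r.
Proof.
elim/P_ind: r.
- exact: left_ore_at_subalgebra.
- apply: (left_ore_at_commutator (@poly_valuesM _ _) (@poly_valuesC _ _)) => s.
  move=> /P_a_commutator[q ->]; apply: left_ore_at_comm => t [p _ ->].
  exact: horner_alg_mulC.
- apply: left_ore_at_comm => t [p _ ->]; exact: horner_alg_comm.
- apply: left_ore_at_comm => t [p _ ->]; exact/horner_alg_comm/P_uc.
Qed.

Lemma right_ore_at_P (r : P) : left_ore_at (R := P^c) T r.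
Proof.
have TM s t : T s -> T t -> T (t * s) by move=> Ts Tt; exact: (poly_valuesM Tt Ts).
have TC s t : T s -> T t -> t * s = s * t by move=> Ts Tt; exact: (poly_valuesC Tt Ts).
elim/P_ind: r.
- exact: right_ore_at_subalgebra.
- apply: (@left_ore_at_commutator P^c T TM TC) => s Ts.
  have [q e] := P_a_commutator Ts.
  have -> : (P_a f g : P^c) * s - s * (P_a f g : P^c) = - P_poly f g q.
    by rewrite -e opprB.
  apply: left_ore_at_comm => t [p _ ->].
  rewrite -[LHS]/(horner_alg (P_c f g) p * - P_poly f g q).
  rewrite -[RHS]/(- P_poly f g q * horner_alg (P_c f g) p).
  by rewrite mulrN mulNr; congr (- _); apply: horner_alg_mulC.
- apply: left_ore_at_comm => t [p _ ->]; exact/esym/horner_alg_comm.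
- apply: left_ore_at_comm => t [p _ ->]; exact/esym/horner_alg_comm/P_uc.
Qed.

Lemma ore_set_P : (forall p, F p -> p != 0) -> ore_set T.
Proof.
move=> F0; have poly0 p : F p -> P_poly f g p <> 0.
  by move=> Fp /P_poly_eq0/eqP; apply/negP/F0.
split=> [|s t|_ x [p Fp ->]|_ x [p Fp ->]||r s Ts].
- exact: poly_values1.
- exact: poly_valuesM.
- by case/(ore_mulf_eq0 (ore_domain_P f g)) => // /(poly0 _ Fp).
- by case/(ore_mulf_eq0 (ore_domain_P f g)) => // /(poly0 _ Fp).
- exact: left_ore_at_P.
- exact: right_ore_at_P.
Qed.

(** The commutators of b with k[c] are values of delta, hence lie in P(f,g). *)
Lemma left_ore_at_skew (D : skew_data P) (r : skew_poly D) :
  skew_aut D (P_c f g) = P_c f g ->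
  left_ore_at (poly_values (skewC D (P_c f g)) F) r.
Proof.
move=> autc; elim/skew_ind: r => [|r|].
- exact: left_ore_at_subalgebra.
- exact: (@left_ore_at_morph _ _ (skewC D) _ _ (left_ore_at_P r)).
- apply: (left_ore_at_commutator (@poly_valuesM _ _) (@poly_valuesC _ _)).
  move=> _ [p Fp ->]; rewrite -(lrmorph_horner_alg (skewC D)).
  rewrite skewX_mulC lrmorph_horner_alg autc addrC addKr.
  exact: (@left_ore_at_morph _ _ (skewC D) _ _ (left_ore_at_P _)).
Qed.

End P.
End PolyValues.

Lemma P_factors_ore (k : fieldType) (f g : {poly k}) : ore_set (@P_factors k f g).
Proof.
pose F p := exists2 ps : seq {poly k},
  (forall p, p \in ps -> irreducible_poly p /\ p %| f) & p = \prod_(p <- ps) p.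
have -> : @P_factors k f g = poly_values (P_c f g) F.
  apply/funext=> s; apply/propext; split=> [[ps hps ->]|[_ [ps hps ->] ->]].
    by exists (\prod_(p <- ps) p) => //; exists ps.
  by exists ps.
apply: ore_set_P => [|_ _ [ps hps ->] [qs hqs ->]|_ [ps hps ->]].
- by exists [::] => //; rewrite big_nil.
- exists (ps ++ qs); last by rewrite big_cat.
  by move=> p; rewrite mem_cat => /orP[/hps|/hqs].
- elim: ps hps => [|p ps IHps] hps; first by rewrite big_nil oner_neq0.
  rewrite big_cons mulf_neq0 ?IHps // => [|q qps].
    have [[sz _] _] := hps p (mem_head _ _).
    by rewrite -size_poly_gt0 (ltn_trans _ sz).
  by apply: hps; rewrite inE qps orbT.
Qed.

(** * The automorphism sigma and the derivation delta *)

(** The three identities express g delta(x) = w x - x w on the generators,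
    where w = g theta. They are stated in a ring where c, g, h, u commute and a
    acts on them as a derivation. Rewriting moves a to the right and sorts the
    other letters; what is left is an identity of free rings. *)
Section Commutators.
Variables (R : nzRingType) (a c g h u : R).
Hypotheses (cg : g * c = c * g) (ch : h * c = c * h) (gh : h * g = g * h).
Hypotheses (uc : u * c = c * u) (ug : u * g = g * u) (uh : u * h = h * u).
Hypotheses (ac : a * c = c * a + c * g) (ag : a * g = g * a + g * h).
Hypotheses (au : a * u = u * a + g * u).
Let w := a ^+ 2 + (u - g) * a.

Let rules := (mulrDl, mulrDr, mulrBl, mulrBr, mulNr, mulrN, mulrA, cg, ch, gh, uc,
  ug, uh, ac, ag, au).

(* The rules again for a factor preceded by a word, since products are
   associated to the left. *)
Let tail (x y z : R) (e : x * y = z) t : t * x * y = t * z.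
Proof. by rewrite -mulrA e. Qed.

Let tails := (tail cg, tail ch, tail gh, tail uc, tail ug, tail uh, tail ac,
  tail ag, tail au).

Lemma commutator_c : g * (c * (h + u + a *+ 2)) = w * c - c * w.
Proof.
by rewrite /w; do 10!rewrite ?(rules, tails, expr2, mulr2n); noncomm.
Qed.

Lemma commutator_u : g * (u * (h + u + a *+ 2)) = w * u - u * w.
Proof.
by rewrite /w; do 10!rewrite ?(rules, tails, expr2, mulr2n); noncomm.
Qed.

Lemma commutator_a : g * ((h - u) * a) = w * a - a * w.
Proof.
by rewrite /w; do 10!rewrite ?(rules, tails, expr2, mulr2n); noncomm.
Qed.

End Commutators.

Section GData.
Variables (k : fieldType) (g : {poly k}).
Hypothesis g0 : g != 0.
Local Notation f := ('X * g).
Local Notation P := (Palg f g).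
Local Notation a := (P_a f g).
Local Notation c := (P_c f g).
Local Notation u := (P_u f g).
Local Notation gc := (P_poly f g g).
Local Notation h := (c * P_poly f g g^`()).
Local Notation gamma := (h + u + a *+ 2).

(** w = g theta, which unlike theta lies in P(f,g). *)
Definition P_w : P := a ^+ 2 + (u - gc) * a.

Lemma P_poly_comm p q : P_poly f g p * P_poly f g q = P_poly f g q * P_poly f g p.
Proof. exact: horner_alg_mulC. Qed.

Lemma P_c_comm p : P_poly f g p * c = c * P_poly f g p.
Proof. exact/esym/horner_alg_comm. Qed.

Lemma P_u_comm p : u * P_poly f g p = P_poly f g p * u.
Proof. exact/horner_alg_comm/P_uc. Qed.

Lemma P_polyXM p : P_poly f g ('X * p) = c * P_poly f g p.
Proof. by rewrite /P_poly horner_algM horner_algX. Qed.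

Lemma P_hE : h = P_poly f g ('X * g^`()).
Proof. by rewrite P_polyXM. Qed.

Lemma P_ac' : a * c = c * a + c * gc.
Proof. by rewrite P_ac P_polyXM. Qed.

Lemma P_ag : a * gc = gc * a + gc * h.
Proof.
have fg' : f * g^`() = g * ('X * g^`()) by rewrite mulrCA mulrA.
by rewrite /P_poly (horner_alg_der g (P_ac f g)) fg' !horner_algM horner_algX.
Qed.

Lemma P_sigma_hom (e : {poly k}) : exists phi : {lrmorphism P -> P},
  [/\ phi a = a + P_poly f g e, phi c = c & phi u = u].
Proof.
apply: P_hom.
- by rewrite mulrDl mulrDr P_ac P_c_comm; noncomm.
- exact: P_uc.
- by rewrite [LHS]mulrDl [u * (_ + _)]mulrDr P_au P_u_comm; noncomm.
Qed.

Lemma P_sigma : exists2 phi : {lrmorphism P -> P}, bijective phi &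
  [/\ phi a = a + h, phi c = c & phi u = u].
Proof.
have [phi [phia phic phiu]] := P_sigma_hom ('X * g^`()).
have [psi [psia psic psiu]] := P_sigma_hom (- ('X * g^`())).
exists phi; last by rewrite P_hE.
exists psi => x.
  apply: (@P_hom_ext _ _ _ _ (psi \o phi : {lrmorphism P -> P}) idfun) => /=.
  - rewrite phia rmorphD /= psia lrmorph_horner_alg psic /P_poly rmorphN.
    by noncomm.
  - by rewrite phic psic.
  - by rewrite phiu psiu.
apply: (@P_hom_ext _ _ _ _ (phi \o psi : {lrmorphism P -> P}) idfun) => /=.
- rewrite psia rmorphD /= phia lrmorph_horner_alg phic /P_poly rmorphN.
  by noncomm.
- by rewrite psic phic.
- by rewrite psiu phiu.
Qed.

Lemma P_lreg x y : gc * x = gc * y -> x = y.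
Proof.
move=> e; apply/eqP; rewrite -subr_eq0; apply/eqP.
have /(ore_mulf_eq0 (ore_domain_P f g))[] // : gc * (x - y) = 0.
  by rewrite mulrBr e subrr.
by move=> /P_poly_eq0 /eqP; rewrite (negPf g0).
Qed.

Lemma P_h_comm : [/\ h * c = c * h, h * gc = gc * h & u * h = h * u].
Proof.
by rewrite P_hE P_c_comm P_u_comm P_poly_comm.
Qed.

Lemma P_commutators :
  [/\ gc * (c * gamma) = P_w * c - c * P_w,
      gc * (u * gamma) = P_w * u - u * P_w
    & gc * ((h - u) * a) = P_w * a - a * P_w].
Proof.
have [hc hg uh] := P_h_comm.
by split; [apply: commutator_c|apply: commutator_u|apply: commutator_a];
  rewrite ?P_c_comm ?P_u_comm ?P_uc ?P_ac' ?P_ag ?P_au.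
Qed.

(** Multiplying the formulas for sigma and delta by g removes the denominators,
    so that they characterize sigma and delta inside P(f,g), where g can be
    cancelled. *)
Record G_data (D : skew_data P) : Prop := GData {
  G_autE : forall r, gc * skew_aut D r = r * gc;
  G_derE : forall r, gc * skew_der D r = P_w * r - r * P_w;
  G_gens_aut : [/\ skew_aut D c = c, skew_aut D u = u & skew_aut D a = a + h];
  G_gens_der : [/\ skew_der D c = c * gamma, skew_der D u = u * gamma
                  & skew_der D a = (h - u) * a]
}.

(** The values delta(r) exist because those r for which w r - r w is divisible
    by g on the left form a subalgebra: if w r - r w = g x and w s - s w = g y,
    then w r s - r s w = g x s + r g y = g (x s + sigma(r) y). Uniqueness of
    the quotient by g makes delta linear and a sigma-derivation. *)
Lemma G_data_ex : exists D : skew_data P, G_data D.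
Proof.
have [sigma sigma_bij [siga sigc sigu]] := P_sigma.
have [hc hg uh] := P_h_comm.
have [ec eu ea] := P_commutators.
have sigmaE : forall r, gc * sigma r = r * gc.
  apply: P_ind => [|||].
  - split=> [|x y ex ey|x y ex ey|b x ex].
    + by rewrite rmorph1 mulr1 mul1r.
    + by rewrite rmorphD mulrDr [RHS]mulrDl ex ey.
    + by rewrite rmorphM mulrA ex -mulrA ey mulrA.
    + by rewrite linearZ /= -[LHS]scalerAr -[RHS]scalerAl ex.
  - by rewrite siga P_ag mulrDr.
  - by rewrite sigc P_c_comm.
  - by rewrite sigu P_u_comm.
have deltaP : forall r, exists x, gc * x = P_w * r - r * P_w.
  apply: P_ind => [|||].
  - split=> [|x y [x' ex] [y' ey]|x y [x' ex] [y' ey]|b x [x' ex]].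
    + by exists 0; rewrite mulr1 mul1r mulr0 subrr.
    + by exists (x' + y'); rewrite mulrDr ex ey; noncomm.
    + exists (x' * y + sigma x * y').
      by rewrite mulrDr !mulrA sigmaE ex -[x * gc * y']mulrA ey; noncomm.
    + exists (b *: x').
      by rewrite -!scalerAr -!scalerAl ex scalerBr.
  - by exists ((h - u) * a).
  - by exists (c * gamma).
  - by exists (u * gamma).
pose delta r := projT1 (cid (deltaP r)).
have deltaE r : gc * delta r = P_w * r - r * P_w by rewrite /delta; case: cid.
have delta_zmod : zmod_morphism delta.
  move=> x y; apply: P_lreg; rewrite mulrBr !deltaE; noncomm.
have deltaZ : scalable delta.
  move=> b x; apply: P_lreg.
  by rewrite -[RHS]scalerAr !deltaE scalerBr -scalerAr -scalerAl.
have deltaM x y : delta (x * y) = sigma x * delta y + delta x * y.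
  apply: P_lreg; rewrite mulrDr !mulrA sigmaE -[x * gc * _]mulrA !deltaE; noncomm.
pose der : {linear P -> P} := HB.pack delta
  (GRing.isZmodMorphism.Build P P delta delta_zmod)
  (GRing.isScalable.Build k P P *:%R delta deltaZ).
exists (@SkewData k P sigma der sigma_bij deltaM); split=> //=.
by split; apply: P_lreg; rewrite deltaE.
Qed.

End GData.

(** Over an algebraically closed field, g is a scalar times a product of linear
    factors, which all divide f. *)
Lemma P_g_unit (k : closedFieldType) (g : {poly k}) (L : unitAlgType k)
    (iota : {lrmorphism Palg ('X * g) g -> L}) :
  g != 0 -> is_fraction_ring (@P_factors k ('X * g) g) iota ->
  iota (P_poly ('X * g) g g) \is a GRing.unit.
Proof.
move=> g0 [unitL _ _ _]; have [zs eg] := closed_field_poly_normal g.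
have e : P_poly ('X * g) g g
    = lead_coef g *: P_poly ('X * g) g (\prod_(z <- zs) ('X - z%:P)).
  rewrite /P_poly -mulr_algl -(horner_algC (P_c ('X * g) g)) -horner_algM mul_polyC.
  exact: (congr1 (horner_alg _) eg).
rewrite e linearZ /= -mulr_algl.
have le0 : lead_coef g != 0 by rewrite lead_coef_eq0.
rewrite unitrMr; last by apply: (rmorph_unit (in_alg L)); rewrite unitfE.
apply: unitL; exists [seq 'X - z%:P | z <- zs]; last by rewrite big_map.
move=> _ /mapP[z zs_z ->]; split; first exact: irredp_XsubC.
rewrite dvdp_mull // eg dvdpZr ?lead_coef_eq0 //.
by rewrite (big_rem z) //= dvdp_mulr.
Qed.

Lemma is_G_dataP (k : closedFieldType) (g : {poly k}) (D : skew_data (Palg ('X * g) g))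
    (L : unitAlgType k) (iota : {lrmorphism Palg ('X * g) g -> L}) :
  g != 0 -> is_fraction_ring (@P_factors k ('X * g) g) iota ->
  G_data D ->
  is_G_data D iota ((iota (P_poly ('X * g) g g))^-1 * iota (P_w g)).
Proof.
move=> g0 fracL [autE derE _ _]; have gU := P_g_unit g0 fracL.
have autL x : iota (skew_aut D x)
    = (iota (P_poly ('X * g) g g))^-1 * iota x * iota (P_poly ('X * g) g g).
  by rewrite -mulrA -rmorphM -autE rmorphM mulKr.
split=> // x; rewrite -[LHS](mulKr gU) -rmorphM derE rmorphB !rmorphM /= autL.
by rewrite !mulrA mulrK // mulrBr !mulrA.
Qed.

(** * Quotient division rings of Ore domains *)

Section ClassicalQuotient.
Variables (k : fieldType) (R : algType k).
Hypothesis oreR : ore_domain R.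

Lemma regularP (s : R) : regular s <-> s != 0.
Proof.
split=> [[lreg_s _]|s0].
  apply/eqP=> s0; have /eqP := oner_neq0 R; apply.
  by apply: lreg_s; rewrite s0 !mul0r.
split=> x y e; apply/eqP; rewrite -subr_eq0; apply/eqP.
  have /(ore_mulf_eq0 oreR)[/eqP|//] : s * (x - y) = 0 by rewrite mulrBr e subrr.
  by rewrite (negPf s0).
have /(ore_mulf_eq0 oreR)[//|/eqP] : (x - y) * s = 0 by rewrite mulrBl e subrr.
by rewrite (negPf s0).
Qed.

Lemma ore_set_regular : ore_set (@regular R).
Proof.
split=> [|s t /regularP s0 /regularP t0|s x /regularP s0|s x /regularP s0|r s|r s].
- exact/regularP/oner_neq0.
- exact/regularP/ore_mulf_neq0.
- by case/(ore_mulf_eq0 oreR) => // /eqP; rewrite (negPf s0).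
- by case/(ore_mulf_eq0 oreR) => // /eqP; rewrite (negPf s0).
- move=> /regularP s0; have [t [x [t0 e]]] := ore_left oreR r s0.
  by exists t, x; split=> //; apply/regularP.
- move=> /regularP s0; have [t [x [t0 e]]] := ore_right oreR r s0.
  by exists t, x; split=> //; apply/regularP.
Qed.

Lemma quotient_division_ring : exists (Q : unitAlgType k) (iota : {lrmorphism R -> Q}),
  [/\ forall q : Q, q != 0 -> q \is a GRing.unit, forall r, iota r = 0 -> r = 0
    & forall q, exists s r, s != 0 /\ iota s * q = iota r].
Proof.
have [Q [iota [unitQ leftQ _ kerQ]]] := ore_localization ore_set_regular.
have iota0 r : iota r = 0 -> r = 0.
  have [[h _] _] := kerQ r; move=> /h[s /regularP s0].
  by case/(ore_mulf_eq0 oreR) => // /eqP; rewrite (negPf s0).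
exists Q, iota; split=> // q.
  have [s [r [/unitQ sU ->]]] := leftQ q => q0.
  rewrite unitrMr ?unitrV //; apply/unitQ/regularP.
  by apply: contraNneq q0 => ->; rewrite rmorph0 mulr0.
have [s [r [Ss ->]]] := leftQ q; exists s, r; split; first exact/regularP.
by rewrite mulVKr // unitQ.
Qed.

(** A quotient ring is recognized by left fractions only: the right Ore
    condition in R rewrites s^-1 r as x t^-1. *)
Lemma classical_quotient_embedding (Q : unitAlgType k) (psi : {lrmorphism R -> Q}) :
  (forall q : Q, q != 0 -> q \is a GRing.unit) -> (forall r, psi r = 0 -> r = 0) ->
  (forall q, exists s r, s != 0 /\ psi s * q = psi r) ->
  is_classical_quotient psi.
Proof.
move=> divQ psi0 fracQ.
have psiU s : s != 0 -> psi s \is a GRing.unit.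
  by move=> s0; apply: divQ; apply: contraNneq s0 => /psi0 ->.
split=> [s /regularP/psiU //|q|q|r].
- have [s [r [s0 e]]] := fracQ q; exists s, r; split; first exact/regularP.
  by rewrite -e mulKr // psiU.
- have [s [r [s0 e]]] := fracQ q.
  have [t [x [t0 ex]]] := ore_right oreR r s0.
  exists t, x; split; first exact/regularP.
  apply: (canRL (mulrK (psiU t t0))); apply: (mulrI (psiU s s0)).
  by rewrite mulrA e -!rmorphM ex.
split; split=> [/psi0 ->|[s /regularP s0]].
- by exists 1; [apply/regularP/oner_neq0|rewrite mulr0].
- by case/(ore_mulf_eq0 oreR) => [/eqP|->]; rewrite ?(negPf s0) ?rmorph0.
- by exists 1; [apply/regularP/oner_neq0|rewrite mul0r].
- by case/(ore_mulf_eq0 oreR) => [->|/eqP]; rewrite ?(negPf s0) ?rmorph0.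
Qed.

End ClassicalQuotient.

(** * Birational equivalence *)

(** y = g (b - theta): since b and theta induce the same sigma-derivation, y
    commutes with P(f,g). *)
Section CentralElement.
Variables (k : fieldType) (g : {poly k}) (D : skew_data (Palg ('X * g) g)).
Hypothesis GD : G_data D.

Definition G_y : skew_poly D :=
  skewC D (P_poly ('X * g) g g) * skewX D - skewC D (P_w g).

Lemma G_y_central r : G_y * skewC D r = skewC D r * G_y.
Proof.
rewrite /G_y mulrBl mulrBr -mulrA skewX_mulC mulrDr !mulrA -!rmorphM /=.
by rewrite (G_autE GD) (G_derE GD) rmorphB /=; noncomm.
Qed.

End CentralElement.

(** The comparison of the algebras belonging to g1 and g2. After inverting
    k[c], each of them is a localized Weyl algebra over the polynomials in u/c
    and y, in which (c g)^-1 a acts as d/dc on k[c]. Identifying c, u, y and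
    this element links the two algebras; for a this reads a1 / g1 = a2 / g2. *)
Section Linked.
Variables (k : fieldType) (g1 g2 : {poly k}).
Variables (D1 : skew_data (Palg ('X * g1) g1)) (D2 : skew_data (Palg ('X * g2) g2)).
Local Notation M1 := (skew_poly D1).
Local Notation M2 := (skew_poly D2).
Local Notation C1 := (skewC D1).
Local Notation C2 := (skewC D2).
Local Notation c1 := (C1 (P_c ('X * g1) g1)).
Local Notation c2 := (C2 (P_c ('X * g2) g2)).
Local Notation u1 := (C1 (P_u ('X * g1) g1)).
Local Notation u2 := (C2 (P_u ('X * g2) g2)).
Local Notation a1 := (C1 (P_a ('X * g1) g1)).
Local Notation a2 := (C2 (P_a ('X * g2) g2)).

Record linked (Q : algType k) (psi1 : {lrmorphism M1 -> Q})
    (psi2 : {lrmorphism M2 -> Q}) : Prop := Linked {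
  linked_c : psi1 c1 = psi2 c2;
  linked_u : psi1 u1 = psi2 u2;
  linked_a : psi1 (horner_alg c1 g2 * a1) = psi2 (horner_alg c2 g1 * a2);
  linked_y : psi1 (G_y D1) = psi2 (G_y D2)
}.

Lemma linked_poly (Q : algType k) (psi1 : {lrmorphism M1 -> Q})
    (psi2 : {lrmorphism M2 -> Q}) p :
  linked psi1 psi2 -> psi1 (horner_alg c1 p) = psi2 (horner_alg c2 p).
Proof. by move=> L; rewrite !lrmorph_horner_alg (linked_c L). Qed.

Hypothesis GD2 : G_data D2.

Section Clearing.
Variables (Q : algType k) (psi1 : {lrmorphism M1 -> Q}) (psi2 : {lrmorphism M2 -> Q}).
Hypothesis L : linked psi1 psi2.

(** The identification maps m to the fraction p(c)^-1 n. *)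
Definition cleared p (m : M1) (n : M2) : Prop :=
  psi1 (horner_alg c1 p) * psi1 m = psi2 n.

Lemma cleared1 m n : psi1 m = psi2 n -> cleared 1 m n.
Proof. by move=> e; rewrite /cleared !rmorph1 mul1r. Qed.

Lemma cleared_scale p q m n :
  cleared p m n -> cleared (q * p) m (horner_alg c2 q * n).
Proof.
rewrite /cleared horner_algM !rmorphM /= -(linked_poly _ L) => <-.
by rewrite mulrA.
Qed.

Lemma clearedD p m m' n n' :
  cleared p m n -> cleared p m' n' -> cleared p (m + m') (n + n').
Proof. by rewrite /cleared => e e'; rewrite !rmorphD /= mulrDr e e'. Qed.

Lemma clearedM p q w z m m' n n' :
  cleared p m n -> cleared q m' n' ->
  horner_alg c2 w * n = z * horner_alg c2 q -> cleared (w * p) (m * m') (z * n').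
Proof.
move=> e e' ez; have /(congr1 psi2) := ez.
rewrite /cleared horner_algM !rmorphM /= -!(linked_poly _ L) -e -e' => ez'.
by rewrite !mulrA -ez' !mulrA.
Qed.

Lemma clearedZ p b m n : cleared p m n -> cleared p (b *: m) (b *: n).
Proof. by rewrite /cleared !linearZ /= => <-; rewrite scalerAr. Qed.

Lemma cleared_a : cleared g2 a1 (horner_alg c2 g1 * a2).
Proof. by rewrite /cleared -rmorphM; apply: (linked_a L). Qed.

Lemma cleared_X p n : cleared p (C1 (P_w g1)) n ->
  cleared (p * g1) (skewX D1) (horner_alg c2 p * G_y D2 + n).
Proof.
rewrite /cleared => e.
have ey : psi1 (horner_alg c1 g1) * psi1 (skewX D1)
    = psi2 (G_y D2) + psi1 (C1 (P_w g1)).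
  by rewrite -(linked_y L) -(lrmorph_horner_alg C1) [in RHS]rmorphB rmorphM subrK.
rewrite horner_algM rmorphM -mulrA [_ * psi1 (skewX D1)]ey mulrDr e.
rewrite [RHS]rmorphD rmorphM; congr (_ * _ + _).
exact: (linked_poly p L).
Qed.

End Clearing.

Hypotheses (g10 : g1 != 0) (g20 : g2 != 0).

(** The numerator n and the denominator p only depend on m, not on the ring
    where the two algebras have been linked. Comparing two such rings, one
    containing the first algebra and one containing the second, shows that
    homomorphisms that are linked to embeddings are injective. *)
Lemma linked_denominator (Q Q' : algType k)
    (psi1 : {lrmorphism M1 -> Q}) (psi2 : {lrmorphism M2 -> Q})
    (psi1' : {lrmorphism M1 -> Q'}) (psi2' : {lrmorphism M2 -> Q'}) :
  linked psi1 psi2 -> linked psi1' psi2' ->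
  forall m, exists (p : {poly k}) (n : M2),
    [/\ p != 0, cleared psi1 psi2 p m n & cleared psi1' psi2' p m n].
Proof.
move=> L L'; have [autc _ _] := G_gens_aut GD2.
pose Pr m := exists (p : {poly k}) (n : M2),
  [/\ p != 0, cleared psi1 psi2 p m n & cleared psi1' psi2' p m n].
have Pr1 m n : psi1 m = psi2 n -> psi1' m = psi2' n -> Pr m.
  by move=> e e'; exists 1, n; rewrite oner_neq0; split=> //; apply: cleared1.
have subPr : subalgebra Pr.
  split=> [|x y [p [n [p0 e e']]] [q [l [q0 el el']]]
            |x y [p [n [p0 e e']]] [q [l [q0 el el']]]|b x [p [n [p0 e e']]]].
  - by apply: (Pr1 _ 1); rewrite !rmorph1.
  - exists (p * q), (horner_alg c2 q * n + horner_alg c2 p * l).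
    split; first by rewrite mulf_neq0.
      by apply: clearedD; [rewrite mulrC|]; apply: cleared_scale.
    by apply: clearedD; [rewrite mulrC|]; apply: cleared_scale.
  (* (p^-1 n) (q^-1 l) = p^-1 (w^-1 z) l, where n q^-1 = w^-1 z. *)
  - have [||_ [z [[w w0 ->] ez]]] :=
      @left_ore_at_skew k (fun p => p != 0) _ _ _ D2 n autc (horner_alg c2 q).
    + by move=> s t; apply: mulf_neq0.
    + by exists q.
    exists (w * p), (z * l); split; first by rewrite mulf_neq0.
      exact: clearedM el ez.
    exact: clearedM el' ez.
  - by exists p, (b *: n); split=> //; apply: clearedZ.
have PrP r : Pr (C1 r).
  elim/P_ind: r.
  - exact: (subalgebra_preim C1 subPr).
  - by exists g2, (horner_alg c2 g1 * a2); split=> //; apply: cleared_a.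
  - by apply: (Pr1 _ c2); [apply: linked_c L|apply: linked_c L'].
  - by apply: (Pr1 _ u2); [apply: linked_u L|apply: linked_u L'].
apply: (skew_ind subPr PrP).
have [p [n [p0 e e']]] := PrP (P_w g1).
exists (p * g1), (horner_alg c2 p * G_y D2 + n).
by split; [rewrite mulf_neq0|apply: cleared_X|apply: cleared_X].
Qed.

End Linked.

Lemma subalgebra_comm (k : fieldType) (A : algType k) (y : A) :
  subalgebra (fun x => y * x = x * y).
Proof.
split=> [|x z ex ez|x z ex ez|b x ex].
- by rewrite mulr1 mul1r.
- by rewrite mulrDr mulrDl ex ez.
- by rewrite mulrA ex -!mulrA ez.
- by rewrite -scalerAr ex scalerAl.
Qed.

Lemma linked_sym (k : fieldType) (g1 g2 : {poly k})
    (D1 : skew_data (Palg ('X * g1) g1)) (D2 : skew_data (Palg ('X * g2) g2))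
    (Q : algType k) (psi1 : {lrmorphism skew_poly D1 -> Q})
    (psi2 : {lrmorphism skew_poly D2 -> Q}) :
  linked psi1 psi2 -> linked psi2 psi1.
Proof. by case=> *; split. Qed.

(** The algebra of g1 maps to every ring Q in which the nonzero polynomials in
    c are invertible and c, u, a satisfy the relations of P(c g2, g2): the
    generator a goes to (g1/g2) a, the value y of the central element can be
    prescribed among the elements commuting with c, u, a, and b is then forced
    to go to g1^-1 (y + w). *)
Section TwistedHom.
Variables (k : fieldType) (g1 g2 : {poly k}) (Q : unitAlgType k) (c u a : Q).
Local Notation G1 := (horner_alg c g1).
Local Notation G2 := (horner_alg c g2).
Hypothesis polyU : forall p, p != 0 -> horner_alg c p \is a GRing.unit.
Hypotheses (g10 : g1 != 0) (g20 : g2 != 0).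
Hypotheses (ac : a * c = c * a + c * G2) (uc : u * c = c * u).
Hypothesis au : a * u = u * a + G2 * u.

Let commV (x z : Q) : x * z = z * x -> x * z^-1 = z^-1 * x.
Proof. exact: commrV. Qed.

Lemma twisted_P_hom : exists phi : {lrmorphism Palg ('X * g1) g1 -> Q},
  [/\ phi (P_a _ _) = G1 * G2^-1 * a, phi (P_c _ _) = c & phi (P_u _ _) = u].
Proof.
have G2c : c * G2^-1 = G2^-1 * c by apply/commV/horner_alg_comm.
have G2u : u * G2^-1 = G2^-1 * u by apply/commV/horner_alg_comm.
have G1c : c * G1 = G1 * c by exact: horner_alg_comm.
have G1u : u * G1 = G1 * u by exact: horner_alg_comm.
have G2V : G2^-1 * G2 = 1 by rewrite mulVr // polyU.
apply: P_hom => //.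
- rewrite horner_algM horner_algX -[_ * a * c]mulrA ac mulrDr; congr (_ + _).
    by rewrite !mulrA -[G1 * _ * c]mulrA -G2c mulrA G1c.
  by rewrite !mulrA -[G1 * _ * c]mulrA -G2c mulrA -[_ * G2]mulrA G2V mulr1 G1c.
- rewrite -[_ * a * u]mulrA au mulrDr; congr (_ + _).
    by rewrite !mulrA -[G1 * _ * u]mulrA -G2u !mulrA G1u.
  by rewrite mulrA -[G1 * _ * _]mulrA G2V mulr1.
Qed.

Lemma twisted_hom (D1 : skew_data (Palg ('X * g1) g1)) (y : Q) :
  G_data D1 -> y * c = c * y -> y * u = u * y -> y * a = a * y ->
  exists psi : {lrmorphism skew_poly D1 -> Q},
    [/\ psi (skewC D1 (P_a _ _)) = G1 * G2^-1 * a,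
        psi (skewC D1 (P_c _ _)) = c, psi (skewC D1 (P_u _ _)) = u
      & psi (G_y D1) = y].
Proof.
move=> GD1 yc yu ya; have [phi [phia phic phiu]] := twisted_P_hom.
have y_poly p : y * horner_alg c p = horner_alg c p * y.
  exact/horner_alg_comm/yc.
have y_phi : forall r, y * phi r = phi r * y.
  apply: (P_ind (subalgebra_preim phi (subalgebra_comm y))).
  - rewrite phia; do 2!apply: (subalgebraM (subalgebra_comm y)) => //.
    exact/commV/y_poly.
  - by rewrite phic yc.
  - by rewrite phiu yu.
have phi_poly p : phi (P_poly _ _ p) = horner_alg c p.
  by rewrite /P_poly lrmorph_horner_alg phic.
pose w := P_w g1; pose b := G1^-1 * (y + phi w).
have bE : G1 * b = y + phi w by rewrite mulVKr ?polyU.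
have [|psi [psiC psiX]] := @skew_hom _ _ D1 Q phi b.
  move=> r; apply: (mulrI (polyU g10)).
  have e1 : G1 * phi (skew_aut D1 r) = phi r * G1.
    by rewrite -phi_poly -!rmorphM (G_autE GD1).
  have e2 : G1 * phi (skew_der D1 r) = phi w * phi r - phi r * phi w.
    by rewrite -phi_poly -!rmorphM (G_derE GD1) rmorphB.
  rewrite mulrA bE mulrDr e2 [G1 * (_ * b)]mulrA e1 -[_ * G1 * b]mulrA bE.
  by rewrite [LHS]mulrDl [phi r * (_ + _)]mulrDr y_phi; noncomm.
exists psi; split; rewrite ?psiC //.
by rewrite /G_y rmorphB rmorphM /= !psiC psiX phi_poly bE addrK.
Qed.

End TwistedHom.

Lemma linked_ex (k : fieldType) (g1 g2 : {poly k})
    (D1 : skew_data (Palg ('X * g1) g1)) (D2 : skew_data (Palg ('X * g2) g2))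
    (Q : unitAlgType k) (iota : {lrmorphism skew_poly D2 -> Q}) :
  G_data D1 -> G_data D2 -> g1 != 0 -> g2 != 0 ->
  (forall q : Q, q != 0 -> q \is a GRing.unit) ->
  (forall r, iota r = 0 -> r = 0) ->
  exists psi : {lrmorphism skew_poly D1 -> Q}, linked psi iota.
Proof.
move=> GD1 GD2 g10 g20 divQ iota0.
pose j : {lrmorphism Palg ('X * g2) g2 -> Q} := iota \o skewC D2.
have j_poly p : horner_alg (j (P_c _ _)) p = j (P_poly _ _ p).
  by rewrite lrmorph_horner_alg.
have polyU p : p != 0 -> horner_alg (j (P_c _ _)) p \is a GRing.unit.
  move=> p0; apply: divQ; rewrite j_poly; apply: contraNneq p0.
  by move=> /iota0/polyC_inj/P_poly_eq0 ->.
have y_comm r : iota (G_y D2) * j r = j r * iota (G_y D2).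
  by rewrite /= -!rmorphM /= G_y_central.
have [||||||psi [psia psic psiu psiy]] := @twisted_hom k g1 g2 Q (j (P_c _ _))
  (j (P_u _ _)) (j (P_a _ _)) polyU g10 g20 _ _ _ D1 (iota (G_y D2)) GD1 => //.
- by rewrite j_poly -!rmorphM -rmorphD P_ac'.
- by rewrite -!rmorphM P_uc.
- by rewrite j_poly -!rmorphM -rmorphD P_au.
exists psi; split=> //.
rewrite !rmorphM /= !lrmorph_horner_alg psic psia.
by rewrite !mulrA (horner_alg_mulC _ g2 g1) mulrK ?polyU.
Qed.

(** The quotient division ring Q2 of the second algebra is also one for the
    first: the homomorphism psi linked to the inclusion of the second algebra
    is injective, by comparison with the quotient division ring of the first,
    and every element of Q2 is a fraction of elements of its image, since each
    element of the second algebra is one. *)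
Lemma birational_G (k : fieldType) (g1 g2 : {poly k})
    (D1 : skew_data (Palg ('X * g1) g1)) (D2 : skew_data (Palg ('X * g2) g2))
    (R : algType k) (theta : {lrmorphism R -> skew_poly D2}) :
  G_data D1 -> G_data D2 -> g1 != 0 -> g2 != 0 -> bijective theta ->
  birational (skew_poly D1) R.
Proof.
move=> GD1 GD2 g10 g20 theta_bij.
have ore1 : ore_domain (skew_poly D1) by apply/ore_domain_skew/ore_domain_P.
have ore2 : ore_domain (skew_poly D2) by apply/ore_domain_skew/ore_domain_P.
have oreR := ore_domain_iso theta_bij ore2.
have [Q1 [iota1 [divQ1 iota1_0 _]]] := quotient_division_ring ore1.
have [Q2 [iota2 [divQ2 iota2_0 fracQ2]]] := quotient_division_ring ore2.
have [psi L] := linked_ex GD1 GD2 g10 g20 divQ2 iota2_0.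
have [psi' /linked_sym L'] := linked_ex GD2 GD1 g20 g10 divQ1 iota1_0.
have psi_0 m : psi m = 0 -> m = 0.
  move=> m0; have [p [n [p0 e e']]] := linked_denominator GD2 g10 g20 L L' m.
  have n0 : n = 0 by apply: iota2_0; rewrite -e m0 mulr0.
  have := iota1_0 (horner_alg (skewC D1 (P_c _ _)) p * m).
  rewrite rmorphM e' n0 rmorph0 => /(_ erefl)/(ore_mulf_eq0 ore1)[|//].
  rewrite -(lrmorph_horner_alg (skewC D1)) => /polyC_inj/P_poly_eq0 p_0.
  by rewrite p_0 eqxx in p0.
have frac_psi q : exists s r, s != 0 /\ psi s * q = psi r.
  have [s [r [s0 e]]] := fracQ2 q; have LS := linked_sym L.
  have [p [m [p0 em _]]] := linked_denominator GD1 g20 g10 LS LS s.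
  have [p' [m' [p0' em' _]]] := linked_denominator GD1 g20 g10 LS LS r.
  have c1 := cleared_scale LS p' em; have c2 := cleared_scale LS p em'.
  exists (horner_alg (skewC D1 (P_c _ _)) p' * m).
  exists (horner_alg (skewC D1 (P_c _ _)) p * m'); split.
    apply: contraNneq s0 => m0; move: c1; rewrite m0 /cleared rmorph0 -rmorphM.
    move=> /iota2_0/(ore_mulf_eq0 ore2)[|-> //].
    rewrite -(lrmorph_horner_alg (skewC D2)) => /polyC_inj/P_poly_eq0/eqP.
    by rewrite mulf_eq0 (negPf p0) (negPf p0').
  by rewrite -c1 -c2 -mulrA e [p * p']mulrC.
have [theta' thetaK theta'K] := theta_bij.
pose iotaR : {lrmorphism R -> Q2} := iota2 \o theta.
exists Q2, psi, Q2, iotaR; split.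
- exact: classical_quotient_embedding.
- apply: classical_quotient_embedding => // [r|q].
    by move=> /iota2_0/(congr1 theta'); rewrite thetaK -(rmorph0 theta) thetaK.
  have [s [r [s0 e]]] := fracQ2 q; exists (theta' s), (theta' r).
  rewrite /= !theta'K; split=> //.
  by apply: contraNneq s0 => s0; rewrite -(theta'K s) s0 rmorph0.
- by exists idfun; exists id.
Qed.

(** * The involution *)

Section Involution.
Variables (k : fieldType) (g : {poly k}) (D : skew_data (Palg ('X * g) g)).
Hypothesis GD : G_data D.
Local Notation f := ('X * g).
Local Notation P := (Palg f g).
Local Notation a := (P_a f g).
Local Notation c := (P_c f g).
Local Notation d := (P_d f g).
Local Notation u := (P_u f g).
Local Notation sigma := (skew_aut D).
Local Notation delta := (skew_der D).

Lemma tau_ex : exists tau : {lrmorphism P -> P}, is_tau tau.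
Proof.
have [|||tau [taua tauc tauu]] := @P_hom k f g P d c (- u).
- exact: P_dc.
- by rewrite mulNr mulrN P_uc.
- by rewrite P_dE mulrN [_ * u]mulrDl P_au; noncomm.
have taud : tau d = a by rewrite {1}P_dE rmorphD /= taua tauu P_dE addrK.
exists tau; split=> // x.
apply: (@P_hom_ext _ _ _ _ (tau \o tau : {lrmorphism P -> P}) idfun) => /=.
- by rewrite taua.
- by rewrite !tauc.
- by rewrite tauu rmorphN /= tauu opprK.
Qed.

(** Fixing b is compatible with the commutation rule because tau commutes with
    sigma and delta, as can be checked on a, c, u. *)
Lemma tau_extends (tau : {lrmorphism P -> P}) : is_tau tau ->
  exists T : {lrmorphism skew_poly D -> skew_poly D},
    [/\ bijective T, forall r, T (skewC D r) = skewC D (tau r)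
      & T (skewX D) = skewX D].
Proof.
case=> tauK taua taud tauc.
have tauu : tau u = - u by rewrite /P_u rmorphB /= taua taud opprB.
have tau_poly p : tau (P_poly f g p) = P_poly f g p.
  by rewrite /P_poly lrmorph_horner_alg tauc.
have [sigc sigu siga] := G_gens_aut GD; have [delc delu dela] := G_gens_der GD.
have [hc hg uh] := P_h_comm g.
(* h is made opaque so that rewriting does not look inside it. *)
have [h hE] : exists h, h = c * P_poly f g g^`() by eexists.
have tauh : tau h = h by rewrite hE rmorphM /= tauc tau_poly.
rewrite -!hE in siga delc delu dela hc hg uh.
have tau_gamma : tau (h + u + a *+ 2) = h - u + d *+ 2.
  by rewrite (rmorphD tau (h + u)) (rmorphD tau h) rmorphMn /= tauh tauu taua.
have sigma_tau : (sigma \o tau : {lrmorphism P -> P}) =1 (tau \o sigma).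
  apply: P_hom_ext => /=.
  - by rewrite taua siga rmorphD /= taua tauh P_dE rmorphD /= siga sigu addrAC.
  - by rewrite tauc sigc tauc.
  - by rewrite tauu rmorphN /= sigu tauu.
have delta_tau : forall r, delta (tau r) = tau (delta r).
  apply: P_ind.
  - split=> [|x y ex ey|x y ex ey|b x ex].
    + by rewrite rmorph1 skew_der1 rmorph0.
    + by rewrite !linearD /= ex ey.
    + rewrite rmorphM !skew_derM rmorphD !rmorphM /= ex ey.
      by have /= -> := sigma_tau x.
    + by rewrite !linearZ /= ex.
  - rewrite taua P_dE linearD /= dela delu rmorphM rmorphB /= tauh tauu taua.
    have e : u * (h + u + a *+ 2) = h * u + u * (u + a *+ 2) by rewrite -uh; noncomm.
    by rewrite P_dE e; noncomm.
  - by rewrite tauc delc (rmorphM tau) /= tau_gamma tauc P_dE; noncomm.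
  - by rewrite tauu linearN /= delu (rmorphM tau) /= tau_gamma tauu P_dE; noncomm.
have [|T [TC TX]] := @skew_hom _ _ D _ (skewC D \o tau) (skewX D).
  by move=> r; rewrite /= skewX_mulC delta_tau; have /= -> := sigma_tau r.
exists T; split=> //; exists T => x;
  apply: (@skew_hom_ext _ _ _ _ (T \o T : {lrmorphism _ -> _}) idfun) => /= [r|];
  by rewrite ?TC /= ?TC /= ?tauK ?TX.
Qed.

End Involution.

(** * The Jordanian matrix algebra *)

(** For g = c, so that h = c, the commutation rules of a, b, c, u and the
    relations of M_J(2) between a, b, c, d imply each other. *)
Section JordanianRelations.
Variables (R : nzRingType) (a b c u : R).

Let d := a + u.

Lemma jordan_relations :
  a * c = c * a + c * c -> u * c = c * u -> a * u = u * a + c * u ->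
  b * c = c * b + c * (c + u + a *+ 2) -> b * u = u * b + u * (c + u + a *+ 2) ->
  b * a = (a + c) * b + (c - u) * a ->
  [/\ b * c = c * b + c * a + c * d + c ^+ 2, d * c = c * d + c ^+ 2,
      b * d = d * b + c * b + c * d - a * d + d ^+ 2,
      d * a = a * d - c * d + c * a
    & b * a = a * b + c * b + c * d - a * d + a ^+ 2].
Proof.
move=> ac uc au bc bu ba; rewrite /d.
by split; do 10!rewrite ?(mulrDl, mulrDr, mulrBl, mulrBr, mulrN, mulNr, expr2,
  mulr2n, bc, bu, ba, ac, uc, au); noncomm.
Qed.

Lemma jordan_relations_inv :
  a * c = c * a + c * c -> u * c = c * u -> a * u = u * a + c * u ->
  b * c = c * b + c * a + c * d + c ^+ 2 ->
  b * d = d * b + c * b + c * d - a * d + d ^+ 2 ->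
  b * a = a * b + c * b + c * d - a * d + a ^+ 2 ->
  [/\ b * c = c * b + c * (c + u + a *+ 2),
      b * u = u * b + u * (c + u + a *+ 2)
    & b * a = (a + c) * b + (c - u) * a].
Proof.
move=> ac uc au bc bd ba.
have bu : b * u = b * d - b * a by rewrite /d; noncomm.
split; rewrite ?bu ?bd ?ba ?bc /d; do 10!rewrite ?(mulrDl, mulrDr, mulrBl, mulrBr,
  mulrN, mulNr, expr2, mulr2n, ac, uc, au); noncomm.
Qed.

End JordanianRelations.

Section JordanianMatrices.
Variable k : fieldType.
Local Notation MJ := (MJ2 k).
Local Notation A := (MJ2_a k).
Local Notation B := (MJ2_b k).
Local Notation C := (MJ2_c k).
Local Notation E := (MJ2_d k).

Lemma MJ2_relations : 
  [/\ A * C = C * A + C ^+ 2, B * C = C * B + C * A + C * E + C ^+ 2,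
      E * C = C * E + C ^+ 2, B * E = E * B + C * B + C * E - A * E + E ^+ 2
    & E * A = A * E - C * E + C * A
      /\ B * A = A * B + C * B + C * E - A * E + A ^+ 2].
Proof.
have [pi [piE _ pi_ker]] := presented_pi (@MJ2_relator_proper k).
have rel x y : MJ2_relator (x - y) -> pi x = pi y.
  move=> /gen_ideal_in/pi_ker/eqP; rewrite rmorphB subr_eq0 => /eqP //.
have := (rel _ _ (MJ2_relator_ac k), rel _ _ (MJ2_relator_bc k),
  rel _ _ (MJ2_relator_dc k), rel _ _ (MJ2_relator_bd k),
  rel _ _ (MJ2_relator_da k), rel _ _ (MJ2_relator_ba k)).
rewrite !(rmorphB, rmorphD, rmorphM, rmorphXn) /= !piE.
by case=> [[[[[]]]]].
Qed.

Lemma MJ2_hom (Q : algType k) (a b c d : Q) :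
  [/\ a * c = c * a + c ^+ 2, b * c = c * b + c * a + c * d + c ^+ 2,
      d * c = c * d + c ^+ 2, b * d = d * b + c * b + c * d - a * d + d ^+ 2
    & d * a = a * d - c * d + c * a
      /\ b * a = a * b + c * b + c * d - a * d + a ^+ 2] ->
  exists phi : {lrmorphism MJ -> Q}, [/\ phi A = a, phi B = b, phi C = c & phi E = d].
Proof.
case=> ac bc dc bd [da ba].
pose x (i : 'I_4) := nth a [:: a; b; c; d] i.
have [|phi phiE] := @presented_hom k 4 _ (@MJ2_relator_proper k) Q x.
  by move=> phi phiE; apply: MJ2_relator_eval; rewrite /= !phiE.
by exists phi; split; exact: phiE.
Qed.

Lemma MJ2_ind (Pr : MJ -> Prop) :
  subalgebra Pr -> Pr A -> Pr B -> Pr C -> Pr E -> forall x, Pr x.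
Proof.
move=> subPr PA PB PC PE; apply: (presented_ind subPr) => -[[|[|[|[|//]]]] lt_i4].
- by move: PA; rewrite /MJ2_a; congr (Pr (gen _ _)); apply: val_inj.
- by move: PB; rewrite /MJ2_b; congr (Pr (gen _ _)); apply: val_inj.
- by move: PC; rewrite /MJ2_c; congr (Pr (gen _ _)); apply: val_inj.
- by move: PE; rewrite /MJ2_d; congr (Pr (gen _ _)); apply: val_inj.
Qed.

Local Notation P := (Palg ('X * 'X : {poly k}) 'X).
Variable D : skew_data P.
Hypothesis GD : G_data D.
Local Notation a := (P_a ('X * 'X : {poly k}) 'X).
Local Notation c := (P_c ('X * 'X : {poly k}) 'X).
Local Notation u := (P_u ('X * 'X : {poly k}) 'X).
Local Notation h := (c * P_poly ('X * 'X : {poly k}) 'X ('X : {poly k})^`()).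

Let hE : h = c.
Proof. by rewrite derivX /P_poly rmorph1 mulr1. Qed.

Let ac : a * c = c * a + c * c.
Proof. by rewrite P_ac /P_poly horner_algM horner_algX. Qed.

Let au : a * u = u * a + c * u.
Proof. by rewrite P_au /P_poly horner_algX. Qed.

Lemma MJ2_to_G : exists phi : {lrmorphism MJ -> skew_poly D},
  [/\ phi A = skewC D a, phi B = skewX D, phi C = skewC D c
    & phi E = skewC D (P_d _ _)].
Proof.
have [sigc sigu siga] := G_gens_aut GD; have [delc delu dela] := G_gens_der GD.
rewrite !hE in siga delc delu dela.
have [|||||| bc dc bd da ba] :=
  @jordan_relations (skew_poly D) (skewC D a) (skewX D) (skewC D c) (skewC D u).
- by rewrite -!rmorphM -rmorphD ac.
- by rewrite -!rmorphM P_uc.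
- by rewrite -!rmorphM -rmorphD au.
- by rewrite skewX_mulC sigc delc rmorphM !rmorphD.
- by rewrite skewX_mulC sigu delu rmorphM !rmorphD.
- by rewrite skewX_mulC siga dela rmorphM rmorphD rmorphB.
rewrite P_dE rmorphD; apply: MJ2_hom; split=> //.
by rewrite -rmorphM ac rmorphD !rmorphM expr2.
Qed.

Lemma G_to_MJ2 : exists psi : {lrmorphism skew_poly D -> MJ},
  [/\ psi (skewC D a) = A, psi (skewX D) = B, psi (skewC D c) = C
    & psi (skewC D u) = E - A].
Proof.
have [sigc sigu siga] := G_gens_aut GD; have [delc delu dela] := G_gens_der GD.
rewrite !hE in siga delc delu dela.
have [AC BC EC BE [EA BA]] := MJ2_relations.
have UC : (E - A) * C = C * (E - A) by rewrite mulrBl EC AC; noncomm.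
have AU : A * (E - A) = (E - A) * A + C * (E - A).
  by rewrite [(E - A) * A]mulrBl EA; noncomm.
have AE : A + (E - A) = E by rewrite addrC subrK.
have [|||||| BC' BU BA'] := @jordan_relations_inv MJ A B C (E - A);
  rewrite ?AE -?expr2 //.
have [|||phi [phia phic phiu]] := @P_hom k ('X * 'X) 'X MJ A C (E - A).
- by rewrite horner_algM horner_algX AC expr2.
- exact: UC.
- by rewrite horner_algX.
have phi_gamma : phi (c + u + a *+ 2) = C + (E - A) + A *+ 2.
  by rewrite (rmorphD phi (c + u)) (rmorphD phi c) rmorphMn /= phia phic phiu.
have [|psi [psiC psiX]] := @skew_hom k _ D MJ phi B.
  apply: P_ind => [|||].
  - split=> [|x y ex ey|x y ex ey|b x ex].
    + by rewrite !rmorph1 skew_der1 rmorph0 mulr1 mul1r addr0.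
    + by rewrite !rmorphD !linearD /= mulrDr ex ey; noncomm.
    + rewrite skew_derM !(rmorphM, rmorphD) /= mulrA ex mulrDl -mulrA ey.
      by noncomm.
    + by rewrite !linearZ /= -scalerAr ex scalerDr scalerAl.
  - rewrite siga dela (rmorphD phi a) (rmorphM phi (c - u)) (rmorphB phi c) /=.
    by rewrite phia phic phiu.
  - by rewrite sigc delc (rmorphM phi c) /= phi_gamma phic.
  - by rewrite sigu delu (rmorphM phi u) /= phi_gamma phiu.
by exists psi; rewrite !psiC.
Qed.

Lemma G_iso_MJ2 : exists (phi : {lrmorphism skew_poly D -> MJ})
    (psi : {lrmorphism MJ -> skew_poly D}),
  [/\ cancel phi psi /\ cancel psi phi, phi (skewC D a) = A,
      phi (skewX D) = B, phi (skewC D c) = C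
    & phi (skewC D (P_d _ _)) = E].
Proof.
have [phi [phiA phiB phiC phiE]] := MJ2_to_G.
have [psi [psia psib psic psiu]] := G_to_MJ2.
have psid : psi (skewC D (P_d _ _)) = E.
  by rewrite P_dE (rmorphD (skewC D) a) (rmorphD psi) /= psia psiu addrC subrK.
exists psi, phi; split=> //; split=> x.
  apply: (@skew_hom_ext _ _ _ _ (phi \o psi : {lrmorphism _ -> _}) idfun) => /= [r|].
    apply: (@P_hom_ext _ _ _ _ (phi \o psi \o skewC D : {lrmorphism _ -> _})
      (skewC D)) => /=.
    - by rewrite psia phiA.
    - by rewrite psic phiC.
    - by rewrite psiu rmorphB /= phiA phiE -rmorphB.
  by rewrite psib phiB.
apply: (MJ2_ind (subalgebra_eq (psi \o phi : {lrmorphism _ -> _}) idfun)) => /=.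
- by rewrite phiA psia.
- by rewrite phiB psib.
- by rewrite phiC psic.
- by rewrite phiE psid.
Qed.

End JordanianMatrices.

Theorem proposition7p8 (k : closedFieldType) (char0 : [pchar k] =i pred0)
    (g : {poly k}) (deg_g : (1 < size g)%N) :
  let f := 'X * g in
  let a := P_a f g in
  let c := P_c f g in
  let d := P_d f g in
  let u := P_u f g in
  let g_c := P_poly f g g in
  let h := c * P_poly f g g^`() in
  let gamma := h + u + a *+ 2 in
  (* the localization of P(f,g) at the irreducible factors of f exists *)
  (exists (L : unitAlgType k) (iota : {lrmorphism Palg f g -> L}),
      is_fraction_ring (@P_factors k f g) iota) /\
  exists D : skew_data (Palg f g),
    [/\ forall (L : unitAlgType k) (iota : {lrmorphism Palg f g -> L}),
          is_fraction_ring (@P_factors k f g) iota ->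
          is_G_data D iota
            ((iota g_c)^-1 * iota (a ^+ 2 + (u - g_c) * a)),
        [/\ skew_aut D c = c, skew_aut D u = u & skew_aut D a = a + h],
        [/\ skew_der D c = c * gamma, skew_der D u = u * gamma
          & skew_der D a = (h - u) * a],
        is_GJMA D
      & f = 'X^2 ->
        exists phi : {lrmorphism skew_poly D -> MJ2 k},
          [/\ bijective phi,
              phi (skewC D a) = MJ2_a k,
              phi (skewX D) = MJ2_b k,
              phi (skewC D c) = MJ2_c k
            & phi (skewC D d) = MJ2_d k]].
Proof.
move=> f a c d u g_c h gamma.
have g0 : g != 0 by rewrite -size_poly_gt0 ltnW.
split; first exact/ore_localization/P_factors_ore.
have [D GD] := G_data_ex g0; exists D; split.
- by move=> L iota fracL; apply: is_G_dataP.
- exact: G_gens_aut GD.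
- exact: G_gens_der GD.
- have [D0 GD0] := G_data_ex (negbT (polyX_eq0 k)).
  split.
    have [phi [psi [[phiK psiK] _ _ _ _]]] := G_iso_MJ2 GD0.
    apply: (@birational_G _ _ _ _ _ _ psi GD GD0 g0 (negbT (polyX_eq0 k))).
    by exists phi.
  have [tau tauP] := tau_ex g; exists tau => //.
  exact: tau_extends.
- rewrite /f expr2 => /(mulfI (negbT (polyX_eq0 k))) gX.
  move: D GD; rewrite /a /c /d /f gX => D GD.
  have [phi [psi [[phiK psiK] phia phib phic phid]]] := G_iso_MJ2 GD.
  by exists phi; split=> //; exists psi.
Qed.
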